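(* Let $V$ be a real reflexive Banach space with norm $\|\cdot\|$, dual $V^*$ and duality brackets $\langle\cdot,\cdot\rangle$, and let $X$ be a real Hilbert space with norm $\|\cdot\|_X$. Let $A\colon V\to V^*$, $j\colon X\times X\to\mathbb{R}$, $M\colon V\to X$, $U\colon V\to 2^V$, $\phi\colon V\to\mathbb{R}$ and $f\in V^*$ satisfy the following. (A) $A$ is pseudomonotone, and there is $m_A>0$ with $\langle Av_1-Av_2,v_1-v_2\rangle\ge m_A\|v_1-v_2\|^2$ for all $v_1,v_2\in V$. (j) (i) $j(w,\cdot)$ is locally Lipschitz for all $w\in X$; (ii) there are $d_1,d_2,d_3\ge 0$ such that $\|\partial j(w,v)\|_X\le d_1+d_2\|w\|_X+d_3\|v\|_X$ for all $w,v\in X$; (iii) the map $X\times X\times X\ni(w,v,z)\mapsto j^0(w,v;z)\in\mathbb{R}$ is upper semicontinuous. (M) $M$ is linear, bounded and compact. (U) $U$ has nonempty, closed, convex values, $0\in U(v)$ for all $v\in V$, and $U$ is weakly Mosco continuous: if $v_n\rightharpoonup v$ weakly in $V$, then $U(v_n)$ converges to $U(v)$ in the Mosco sense. ($\phi$) $\phi$ is convex and lower semicontinuous on $V$, and there is $c_\phi>0$ such that $\phi(v_1)-\phi(v_2)\le c_\phi\|v_1-v_2\|$ for all $v_1,v_2\in V$. Assume moreover that $(d_2+d_3)\|M\|^2<m_A$. Then there exists $u\in V$ such that $u\in U(u)$ and $$\langle Au-f,z-u\rangle+j^0(Mu,Mu;Mz-Mu)+\phi(z)-\phi(u)\ge 0\quad\text{for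 all } z\in U(u).$$
   Context: For a locally Lipschitz function $h\colon X\to\mathbb{R}$, the Clarke generalized directional derivative is $h^0(x;v)=\limsup_{y\to x,\ \lambda\downarrow 0}\frac{h(y+\lambda v)-h(y)}{\lambda}$ and the generalized subgradient is $\partial h(x)=\{\zeta\in X^*\mid h^0(x;v)\ge\langle\zeta,v\rangle\ \text{for all } v\in X\}$; here $X^*$ is identified with the Hilbert space $X$. For $j\colon X\times X\to\mathbb{R}$, $j^0(w,v;z)$ and $\partial j(w,v)$ denote the generalized directional derivative (in direction $z$) and the generalized subgradient of $j(w,\cdot)$ at $v$, with $w$ fixed. For a set $S$, $\|S\|_X=\sup\{\|x\|_X\mid x\in S\}$. $\|M\|$ is the operator norm. An operator $A\colon V\to V^*$ is pseudomonotone if it maps bounded sets into bounded sets and, whenever $u_n\rightharpoonup u$ in $V$ with $\limsup\langle Au_n,u_n-u\rangle\le 0$, one has $\langle Au,u-v\rangle\le\liminf\langle Au_n,u_n-v\rangle$ for all $v\in V$. A sequence $\{C_n\}$ of closed convex subsets of a normed space $Y$ converges in the Mosco sense to a closed convex set $C\subset Y$ if: $(m_1)$ whenever $z_n\in C_n$ and $z_n\rightharpoonup z$ weakly in $Y$ along a subsequence, then $z\in C$; $(m_2)$ for every $z\in C$ there exist $z_n\in C_n$ with $z_n\to z$ strongly in $Y$. *)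

(* Defs.v *)
From HB Require Import structures.
From mathcomp Require Import all_boot all_order all_algebra.
From mathcomp Require Import all_classical all_reals all_analysis.

Set Implicit Arguments.
Unset Strict Implicit.
Unset Printing Implicit Defensive.

Import Order.TTheory GRing.Theory Num.Theory.
Import numFieldNormedType.Exports.

Local Open Scope classical_set_scope.
Local Open Scope ring_scope.

(* For a linear map that is not bounded, this is the junk value of [sup]. *)
Definition opnorm {R : realType} {V W : normedModType R} (f : V -> W) : R :=
  sup [set `|f x| | x in [set x : V | `|x| <= 1]].

Section Dual.
Context {R : realType} (V : normedModType R).

Definition dual_pred : {pred V -> R^o} :=
  fun f => `[< linear f /\ continuous f >].

Record dual := Dual { dual_fun :> V -> R^o; _ : dual_fun \in dual_pred }.

HB.instance Definition _ := [isSub for dual_fun].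
HB.instance Definition _ := [Choice of dual by <:].

Fact dual_submod_closed : submod_closed dual_pred.
Proof.
split=> [|a f g /asboolP[lf cf] /asboolP[lg cg]]; apply/asboolP; split.
- by move=> a x y; rewrite /GRing.zero /= scaler0 addr0.
- by move=> x; exact: cvg_cst.
- have E z : (a *: f + g) z = a *: f z + g z by [].
  move=> b x y; rewrite !E lf lg !scalerDr addrACA; congr (_ + _ + _).
  by rewrite !scalerA mulrC.
- move=> x; apply: (@cvgD _ R^o); last exact: cg.
  by apply: (@cvgZl_tmp _ R^o); exact: cf.
Qed.

HB.instance Definition _ :=
  GRing.isSubmodClosed.Build R (V -> R^o) dual_pred dual_submod_closed.
HB.instance Definition _ := [SubChoice_isSubLmodule of dual by <:].

Fact dual_is_linear (f : dual) : linear f.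
Proof. by case: f => f fP /=; case/asboolP: fP. Qed.

Fact dual_continuous (f : dual) : continuous f.
Proof. by case: f => f fP /=; case/asboolP: fP. Qed.

HB.instance Definition _ (f : dual) :=
  GRing.isLinear.Build R V R^o *:%R f (@dual_is_linear f).

Fact dual_has_sup (f : dual) :
  has_sup [set `|f x| | x in [set x : V | `|x| <= 1]].
Proof.
split; first by exists `|f 0|, 0 => //=; rewrite normr0.
have /linear_boundedP := continuous_linear_bounded (0 : V)
  (@dual_continuous f 0 : {for 0, continuous f}).
case/pinfty_ex_gt0 => r r0 rf; exists r => _ [x /= x1 <-].
by rewrite (le_trans (rf x))// ler_piMr// ltW.
Qed.

Fact dual_le_opnorm (f : dual) x : `|x| <= 1 -> `|f x| <= opnorm f.
Proof. by move=> x1; apply: ub_le_sup; [case: (dual_has_sup f)|exists x]. Qed.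

Fact dual_opnorm_le (f : dual) c :
  (forall x, `|x| <= 1 -> `|f x| <= c) -> opnorm f <= c.
Proof.
move=> fc; apply: ge_sup; first by case: (dual_has_sup f).
by move=> _ [x /= x1 <-]; exact: fc.
Qed.

Fact dual_opnormD (f g : dual) : opnorm (f + g) <= opnorm f + opnorm g.
Proof.
apply: dual_opnorm_le => x x1.
by rewrite (le_trans (ler_normD _ _))// lerD// dual_le_opnorm.
Qed.

Fact dual_opnormZ_le (a : R) (f : dual) : opnorm (a *: f) <= `|a| * opnorm f.
Proof.
apply: dual_opnorm_le => x x1.
by rewrite [leLHS]normrM ler_wpM2l// dual_le_opnorm.
Qed.

Fact dual_opnormZ (a : R) (f : dual) : opnorm (a *: f) = `|a| * opnorm f.
Proof.
apply/le_anti; rewrite dual_opnormZ_le/=.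
have [->|a0] := eqVneq a 0.
  rewrite normr0 mul0r; have: `|0 : V| <= 1 by rewrite normr0.
  by move/(@dual_le_opnorm (0 *: f)); exact: le_trans.
rewrite -ler_pdivlMl ?normr_gt0// -normfV.
by rewrite -{1}[f](scalerK a0) dual_opnormZ_le.
Qed.

Fact dual_opnorm0_eq0 (f : dual) : opnorm f = 0 -> f = 0.
Proof.
move=> f0; apply/val_inj/funext => x /=.
have [->|x0] := eqVneq x 0; first by rewrite linear0.
have x1 : Num.norm (`|x|^-1 *: x) <= 1.
  by rewrite normrZ normfV normr_id mulVf ?normr_eq0.
have := dual_le_opnorm f x1; rewrite f0 normr_le0 linearZ /= => /eqP/(congr1 (fun y => `|x| *: y)).
by rewrite scalerA divff ?normr_eq0// scale1r scaler0.
Qed.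

HB.instance Definition _ := @Lmodule_isNormed.Build R dual
  (fun f => opnorm f) dual_opnormD dual_opnormZ dual_opnorm0_eq0.

End Dual.

Definition reflexive_space {R : realType} (V : normedModType R) : Prop :=
  forall Phi : dual (dual V), exists v : V, forall g : dual V, Phi g = g v.

Definition weak_cvg {R : realType} {V : normedModType R}
    (u : nat -> V) (v : V) : Prop :=
  forall g : dual V, g (u n) @[n --> \oo] --> g v.

Definition pseudomonotone {R : realType} {V : normedModType R}
    (A : V -> dual V) : Prop :=
  (forall B : set V, bounded_set B -> bounded_set (A @` B)) /\
  forall (un : nat -> V) (u : V), weak_cvg un u ->
    (limn_esup (fun n => (A (un n) (un n - u))%:E) <= 0)%E ->
    forall v : V,
      ((A u (u - v))%:E <= limn_einf (fun n => (A (un n) (un n - v))%:E))%E.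

Definition mosco_cvg {R : realType} {Y : normedModType R}
    (C : nat -> set Y) (D : set Y) : Prop :=
  (forall (zn : nat -> Y) (s : nat -> nat) (z : Y),
     (forall n, C n (zn n)) -> increasing_seq s ->
     weak_cvg (zn \o s) z -> D z) /\
  (forall z : Y, D z ->
     exists2 zn : nat -> Y, forall n, C n (zn n) & zn @ \oo --> z).

Definition weakly_mosco_continuous {R : realType} {V : normedModType R}
    (U : V -> set V) : Prop :=
  forall (vn : nat -> V) (v : V),
    weak_cvg vn v -> mosco_cvg (fun n => U (vn n)) (U v).

Definition locally_lipschitz {R : realType} {X : normedModType R}
    (h : X -> R^o) : Prop :=
  forall x : X, exists2 N, nbhs x N & [lipschitz h y | y in N].

(* Extended-real valued; finite whenever [h] is locally Lipschitz. *)
Definition clarke_derivative {R : realType} {X : normedModType R}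
    (h : X -> R) (x v : X) : \bar R :=
  limf_esup (fun p : X * R => ((h (p.1 + p.2 *: v) - h p.1) / p.2)%:E)
    (filter_prod (nbhs x) (0 : R)^'+).

(* Subset of the Hilbert space [X], its dual being identified with [X] through
   the inner product [ip]. *)
Definition clarke_subgradient {R : realType} {X : normedModType R}
    (ip : X -> X -> R) (h : X -> R) (x : X) : set X :=
  [set zeta | forall v : X, ((ip zeta v)%:E <= clarke_derivative h x v)%E].

Definition set_norm {R : realType} {X : normedModType R} (S : set X) : \bar R :=
  ereal_sup [set `|x|%:E | x in S].

Definition upper_semicontinuous {R : realType} {T : topologicalType}
    (f : T -> \bar R) : Prop :=
  forall (x : T) (a : R), (f x < a%:E)%E ->
    exists2 N, nbhs x N & forall y, N y -> (f y < a%:E)%E.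

Definition compact_map {R : realType} {V W : normedModType R}
    (f : V -> W) : Prop :=
  forall B : set V, bounded_set B -> precompact (f @` B).

(* Main.v *)
(* Fix [w] and [xi] and solve the variational inequality on [U w] in which the Clarke term is
   replaced by [<xi, Mz - Mu>]: Minty's trick, weak compactness and strong monotonicity give a
   unique solution [u]. The gradients [xi] are chosen along a partition of unity subordinate to a
   finite net of the relatively compact set [M B_r], so [xi] depends continuously on [w] and
   is a convex combination of Clarke subgradients taken at points near [Mw]. By (U) and the
   compactness of [M] the map [w |-> u] is continuous with relatively compact range, and the
   smallness condition makes it preserve a ball [B_r]; Schauder's argument then provides [w] with
   [|w - u|] small. Along a weakly convergent subsequence of such pairs, Mosco continuity and
   pseudomonotonicity give strong convergence, and upper semicontinuity of [j^0] turns the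
   convex combinations into [j^0(Mu, Mu; Mz - Mu)] in the limit.

   Brouwer's theorem is obtained from Scarf's lemma, following the proof of Petri and
   Voorneveld. Weak compactness is handled with ultrafilters: in a reflexive space
   every bounded family has a weak limit along every ultrafilter. *)

Require Import Defs.
From mathcomp Require Import all_boot all_order all_algebra.

Set Implicit Arguments.
Unset Strict Implicit.
Unset Printing Implicit Defensive.

(** * Scarf's lemma *)

(** The Clarke subgradient in general has no continuous selection, so solving with exact
    subgradients would require a set-valued fixed point theorem. Averaging finitely many of them
    gives a continuous single-valued substitute. The average need not be a subgradient at any point,
    but a bound [ip zeta y <= b] shared by the averaged [zeta] passes to it, and the limit needs no
    more than such bounds: upper semicontinuity supplies them with [b = j^0(Mu, Mu; Mz - Mu) + e].
    The subgradients are diagonal, those of [j y] at [y], so the growth constants enter only through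
    [d2 + d3].

    Duality theory has a single source here: a convex Lipschitz function has a subgradient at every
    point. Applied to the norm it yields norming functionals, applied to the distance to a convex
    set it yields separation, and applied to [phi] it yields Jensen's inequality and weak lower
    semicontinuity. *)

Section Scarf.
Variables (I X : finType) (c : I -> X -> nat) (w : X -> I).
Hypothesis c_inj : forall i, injective (c i).
Implicit Types (T : {set X}) (S : {set I}) (d r : {set X} * {set I}).

(** Scarf's dominance: no [x] lies strictly above the [c i]-minimum of [T] for all [i] in [S] at
    once. *)
Definition dominant T S :=
  [forall x, exists i in S, forall t in T, c i x <= c i t].

Lemma dominantP T S : reflect
  (forall x, exists2 i, i \in S & forall t, t \in T -> c i x <= c i t)
  (dominant T S).
Proof.
apply: (iffP forallP) => H x.
  have /exists_inP[i iS /forall_inP Hi] := H x.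
  by exists i.
by have [i iS Hi] := H x; apply/exists_inP; exists i => //; apply/forall_inP.
Qed.

Lemma dominantPn T S : ~~ dominant T S ->
  exists x, forall i, i \in S -> exists2 t, t \in T & c i t < c i x.
Proof.
rewrite negb_forall => /existsP[x]; rewrite negb_exists_in => /forall_inP H.
exists x => i /H; rewrite negb_forall_in => /exists_inP[t tT].
by rewrite -ltnNge; exists t.
Qed.

(* Rooms and doors as in parity proofs of Sperner's lemma: a door with nonempty first
   component leads to exactly two rooms, the doors [(set0, [set i])] to exactly one. *)
Definition room r := dominant r.1 r.2 && (#|r.1| == #|r.2|).

Definition door d := dominant d.1 d.2 && (#|d.1|.+1 == #|d.2|).

Definition inc d r := (d.1 \subset r.1) && (r.2 \subset d.2).

(** The cardinalities force one of the two inclusions to be an equality and the other to miss a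
    single element. *)
Lemma inc_room d r : door d -> room r -> inc d r ->
  (exists2 x, x \notin d.1 & r = (x |: d.1, d.2)) \/
  (exists2 i, i \in d.2 & r = (d.1, d.2 :\ i)).
Proof.
case: d r => [T S] [T' S'] /andP[_ /=/eqP cd] /andP[_ /=/eqP cr] /andP[/= sT sS].
have := subset_leqif_cards sT; have := subset_leqif_cards sS.
case: (boolP (T == T')) => [/eqP eT|nT].
  move=> _ _; right.
  have cSD : #|S :\: S'| = 1.
    by rewrite cardsD (setIidPr sS) -cd -cr eT subSn// subnn.
  have /cards1P[i Si] : #|S :\: S'| == 1 by rewrite cSD.
  have iS : i \in S :\: S' by rewrite Si set11.
  exists i; first by case/setDP: iS.
  congr pair; first by rewrite eT.
  by rewrite -Si setDDr setDv set0U (setIidPr sS).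
move=> [leS eS] [leT eTT]; left.
have ltT : #|T| < #|T'| by rewrite ltn_neqAle eTT leT.
have eST : S' = S.
  by apply/eqP; rewrite -eS eqn_leq leS /= -cd -cr.
subst S'.
have cTD : #|T' :\: T| = 1.
  by rewrite cardsD (setIidPr sT) cr -cd subSn// subnn.
have /cards1P[x Tx] : #|T' :\: T| == 1 by rewrite cTD.
have xT : x \in T' :\: T by rewrite Tx set11.
exists x; first by case/setDP: xT.
by congr pair; rewrite -Tx -{1}(setID T' T) (setIidPr sT) setUC.
Qed.

(** By counting, [f] identifies just one pair of elements of [S], and only these two can be removed
    without losing a value. *)
Lemma surj_collision (aT rT : finType) (f : aT -> rT) (S : {set aT}) (T : {set rT}) :
  f @: S = T -> #|S| = #|T|.+1 -> #|[set k in S | f @: (S :\ k) == T]| = 2.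
Proof.
move=> fS cS.
have /dinjectivePn[i iS [j]] : ~~ dinjectiveb f (mem S).
  apply/negP => /dinjectiveP /imset_injP/eqP.
  by rewrite fS cS => /eqP; rewrite eqn_leq ltnn andbF.
rewrite !inE => /andP[ji jS] fij.
suff -> : [set k in S | f @: (S :\ k) == T] = [set i; j].
  by rewrite cards2 eq_sym ji.
apply/setP => k; rewrite !inE.
have surj a b : a \in S -> b \in S -> b != a -> f a = f b -> f @: (S :\ a) = T.
  move=> aS bS ba fab; apply/setP => t; rewrite -fS.
  apply/imsetP/imsetP => [[x]|[x xS tx]].
    by rewrite !inE => /andP[_ xS] ->; exists x.
  have [xa|xa] := eqVneq x a; last by exists x => //; rewrite !inE xa.
  by exists b; rewrite ?inE ?ba// tx xa.
apply/andP/orP => [[kS /eqP fk]|]; last first.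
  case=> /eqP ->; split=> //; apply/eqP; first exact: (surj _ j).
  by apply: (surj _ i) => //; rewrite eq_sym.
have /imset_injP injk : #|f @: (S :\ k)| == #|S :\ k|.
  by have := cardsD1 k S; rewrite kS cS fk add1n => -[->].
have [ki|ki] := eqVneq k i; first by left.
have [kj|kj] := eqVneq k j; first by right.
by move: ji; rewrite (injk j i) ?eqxx// !inE ?jS ?iS eq_sym ?kj ?ki.
Qed.

Lemma inc_roomT T S i : i \in S -> inc (T, S) (T, S :\ i).
Proof. by move=> iS; rewrite /inc /= subxx subD1set. Qed.

Lemma door_rooms d : d.1 != set0 -> door d ->
  #|[set r | room r && inc d r]| = 2.
Proof.
case: d => T S /= /set0Pn[t0 t0T] Dd.
have /andP[/dominantP /= domTS /= /eqP cS] := Dd.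
pose mt i := [arg min_(t < t0 in T) c i t].
have mtT i : mt i \in T by rewrite /mt; case: arg_minnP.
have mt_le i t : t \in T -> c i (mt i) <= c i t.
  by rewrite /mt; case: arg_minnP => // ? _ + tT; exact.
have mt_eq i t : t \in T -> (forall s, s \in T -> c i t <= c i s) -> mt i = t.
  move=> tT tm; apply: (@c_inj i); apply/eqP.
  by rewrite eqn_leq mt_le// tm.
have mtS : mt @: S = T.
  apply/setP => t; apply/imsetP/idP => [[i _ ->//]|tT].
  by have [i iS /mt_eq <-//] := domTS t; exists i.
rewrite -(surj_collision mtS) ?cS//.
(* The points of [bad i] refute dominance once [i] leaves [S]. If there are none, dropping [i] gives
   a room; otherwise the [c i]-highest of them joins [T]. *)
pose bad i := [set x | [forall k in S :\ i, c k (mt k) < c k x]].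
have badP i x : reflect (forall k, k \in S -> k != i -> c k (mt k) < c k x)
    (x \in bad i).
  rewrite inE; apply: (iffP forall_inP) => H k; first by move=> kS ki; rewrite H// !inE ki.
  by rewrite !inE => /andP[ki kS]; exact: H.
have dom_bad i : dominant T (S :\ i) = (bad i == set0).
  apply/idP/eqP => [/dominantP dom|b0].
    apply/setP => x; rewrite [RHS]inE; apply/badP => xb.
    have [k] := dom x; rewrite !inE => /andP[ki kS] /(_ _ (mtT k)).
    by rewrite leqNgt xb.
  apply/negPn/negP => /dominantPn[x xP].
  have : x \in bad i; last by rewrite b0 inE.
  apply/badP => k kS ki; have [|t tT] := xP k; first by rewrite !inE ki.
  exact/leq_ltn_trans/mt_le.
pose R i := if [pick x in bad i] is Some x0
  then ([arg max_(x > x0 in bad i) c i x] |: T, S) else (T, S :\ i).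
have bad_notin i x : i \in S -> mt @: (S :\ i) = T -> x \in bad i -> x \notin T.
  move=> iS mi /badP xb; apply/negP; rewrite -{1}mi => /imsetP[k].
  rewrite !inE => /andP[ki kS] xk; have := xb k kS ki.
  by rewrite xk ltnn.
have Rspec i : (bad i = set0 /\ R i = (T, S :\ i)) \/
   (exists2 x, x \in bad i /\ (forall y, y \in bad i -> c i y <= c i x) & R i = (x |: T, S)).
  rewrite /R; case: pickP => [x0 x0b|b0]; last first.
    by left; split => //; apply/setP => x; rewrite b0 inE.
  right; case: arg_maxnP => // x xb xm; exists x => //.
rewrite -(card_in_imset (f := R) (D := mem [set k in S | mt @: (S :\ k) == T])); last first.
  move=> i j; rewrite !inE => /andP[iS /eqP mi] /andP[jS /eqP mj].
  case: (Rspec i) => [[bi ->]|[x [xb xm] ->]];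
    case: (Rspec j) => [[bj ->]|[y [yb ym] ->]].
  - move=> [] /setP eS; apply/eqP/negP => /negP ij.
    by have := eS i; rewrite !inE eqxx iS ij.
  - by move=> [_ /setP/(_ i)]; rewrite !inE eqxx iS.
  - by move=> [_ /setP/(_ j)]; rewrite !inE eqxx jS.
  move=> [] /setP/(_ x); rewrite !inE eqxx /= (negbTE (bad_notin _ _ iS mi xb)) orbF.
  move=> /esym/eqP xy; subst y; apply/eqP/negP => /negP ij.
  have [k kS kx] := domTS x.
  have : c k (mt k) < c k x.
    have [ki|ki] := eqVneq k i; last by move/badP: xb; apply.
    by move/badP: yb; apply=> //; rewrite ki.
  by rewrite ltnNge kx.
apply: eq_card => r; rewrite inE.
apply/andP/imsetP => [[rr ir]|[i]].
  have [[x xT er]|[i iS er]] := inc_room Dd rr ir.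
    case/andP: rr => + _; rewrite er /= => /dominantP dom'.
    have [i iS ix] := dom' x.
    have cov k t : k \in S -> (forall s, s \in x |: T -> c k x <= c k s) ->
        t \in T -> exists2 l, l \in S :\ i :\ k & mt l = t.
      move=> kS kx tT; have [l lS lt] := dom' t.
      exists l; last by apply: mt_eq => // s sT; rewrite lt// setU1r.
      have tx : t != x by apply: contraNneq xT => <-.
      have aux a : (forall s, s \in x |: T -> c a x <= c a s) -> l != a.
        move=> ax; apply: contraNneq tx => la; apply/eqP/(@c_inj a)/eqP.
        by rewrite eqn_leq ax ?setU1r// andbT -la lt ?setU11.
      by rewrite !inE lS !aux.
    (* Were [x] minimal for a second index [k], only [#|T| - 1] indices would remain to attain the
       points of [T]. *)
    have ltx k : k \in S -> k != i -> c k (mt k) < c k x.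
      move=> kS ki; rewrite ltnNge; apply/negP => kx.
      have kx' s : s \in x |: T -> c k x <= c k s.
        by rewrite !inE => /orP[/eqP->//|sT]; exact: leq_trans (mt_le _ _ sT).
      have /subset_leq_card : T \subset mt @: (S :\ i :\ k).
        by apply/subsetP => t /(cov k t kS kx')[l lS <-]; exact: imset_f.
      have := leq_imset_card mt (S :\ i :\ k).
      have := cardsD1 i S; have := cardsD1 k (S :\ i).
      rewrite !inE ki kS iS /= -cS => e1 e2 l1 l2; have := leq_trans l2 l1.
      by move: e2; rewrite e1 !add1n => -[->]; rewrite ltnn.
    have mi : mt @: (S :\ i) = T.
      apply/setP => t; apply/imsetP/idP => [[l _ ->//]|].
      by move/(cov i t iS ix) => [l]; rewrite 2!inE => /andP[_ lS] <-; exists l.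
    have xb : x \in bad i by apply/badP.
    exists i; first by rewrite inE iS mi eqxx.
    case: (Rspec i) => [[b0 _]|[y [yb ym] ->]]; first by rewrite b0 inE in xb.
    congr (_ |: _, _); apply: (@c_inj i); apply/eqP.
    rewrite eqn_leq ym//=; have [l lS ly] := dom' y.
    have [->|li] := eqVneq i l; first by rewrite ly// setU11.
    have := ly (mt l); rewrite setU1r// leqNgt => /(_ isT)/negP[].
    by move/badP: yb; apply=> //; rewrite eq_sym.
  case/andP: rr => domr _; rewrite er /= dom_bad in domr.
  exists i; last by rewrite er; case: (Rspec i) => [[_ ->//]|[x [xb _] _]];
    rewrite (eqP domr) inE in xb.
  rewrite inE iS /=; apply/eqP/setP => t; apply/imsetP/idP => [[l _ ->//]|tT].
  move: domr; rewrite -dom_bad => /dominantP/(_ t)[l lS lt].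
  by exists l => //; rewrite (mt_eq l t).
rewrite inE => /andP[iS /eqP mi] ->.
case: (Rspec i) => [[b0 ->]|[x [xb xm] ->]].
  split; last exact: inc_roomT.
  rewrite /room /= dom_bad b0 eqxx /=; have := cardsD1 i S.
  by rewrite iS -cS => -[->].
have xT := bad_notin _ _ iS mi xb.
split; last by rewrite /inc /= subsetUr subxx.
apply/andP; split; last by rewrite /= cardsU1 xT -cS.
apply/dominantP => /= y; have [yb|/badP nyb] := boolP (y \in bad i).
  exists i => // t; rewrite !inE => /orP[/eqP->|tT]; first exact: xm.
  apply: leq_trans (xm _ yb) _.
  have [k kS kx] := domTS x; have [<-|ki] := eqVneq k i; first exact: kx.
  by move/badP: xb => /(_ k kS ki); rewrite ltnNge kx.
have [k kS /andP[ki ky]] : exists2 k, k \in S & (k != i) && (c k y <= c k (mt k)).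
  apply/exists_inP; apply: contra_notT nyb => nex k kS ki.
  rewrite ltnNge; apply: contra nex => ky.
  by apply/exists_inP; exists k => //; rewrite ki.
exists k => // t; rewrite !inE => /orP[/eqP->|tT].
  by apply: (leq_trans ky); apply: ltnW; move/badP: xb; apply.
exact/(leq_trans ky)/mt_le.
Qed.

Variables (i0 : I) (x0 : X).

(** Counterpart of the almost completely labelled facets in Sperner's lemma; [i0] is the missing
    colour. *)
Definition good d := [&& door d, i0 \in d.2 & w @: d.1 == d.2 :\ i0].

Lemma good_set0 d : good d -> d.1 = set0 -> d = (set0, [set i0]).
Proof.
case: d => T S /and3P[/andP[_ /= cS] iS _] T0; move: cS; rewrite T0 cards0.
by rewrite eq_sym => /cards1P[j Sj]; move: iS; rewrite /= Sj inE => /eqP->.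
Qed.

(** Adding a point keeps dominance only for the [c i0]-largest one, and dropping [i0] would leave no
    index. *)
Lemma door_rooms0 : #|[set r | room r && inc (set0, [set i0]) r]| = 1.
Proof.
pose m := [arg max_(x > x0) c i0 x].
have mP x : c i0 x <= c i0 m by rewrite /m; case: arg_maxnP => // y _; apply.
have D0 : door (set0, [set i0]).
  rewrite /door /= cards0 cards1 andbT; apply/dominantP => x.
  by exists i0; rewrite ?inE// => t; rewrite inE.
have domm : dominant [set m] [set i0].
  by apply/dominantP => x; exists i0; rewrite ?inE// => t; rewrite inE => /eqP->.
apply/eqP/cards1P; exists ([set m], [set i0]); apply/setP => r; rewrite !inE.
apply/andP/eqP => [[rr ir]|->]; last first.
  by rewrite /room /inc /= !cards1 sub0set subxx domm.
have [[x /= _ er]|[i /= iS er]] := inc_room D0 rr ir; move: rr; rewrite er /room /=.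
  move=> /andP[/dominantP/(_ m)[k]]; rewrite inE => /eqP-> /(_ x).
  rewrite setU11 => /(_ isT) mx _; congr pair; rewrite setU0.
  by congr [set _]; apply: (@c_inj i0); apply/eqP; rewrite eqn_leq mP mx.
move: iS; rewrite inE => /eqP ->; rewrite setDv => /andP[/dominantP/(_ x0)[k]].
by rewrite inE.
Qed.

Definition complete r := w @: r.1 == r.2.

(** One good door yields a point [t] whose removal leaves the labels [S :\ i0], and then there are
    exactly two good doors. If [w t] is in [S], it repeats a label, and the doors remove one or the
    other point with that label. If not, the doors are [(T :\ t, S)] and [(T, w t |: S)]. *)
Lemma room_doors r : room r -> ~~ complete r ->
  ~~ odd #|[set d | good d && inc d r]|.
Proof.
move=> rr nc; have [->|/set0Pn[d0]] := eqVneq [set d | good d && inc d r] set0.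
  by rewrite cards0.
rewrite inE; case: r rr nc => T S rr; have /andP[/dominantP /= dom /eqP /= cTS] := rr.
rewrite /complete /= => nc /andP[gd0 id0].
have [iS [t tT wt]] : i0 \in S /\ exists2 t, t \in T & w @: (T :\ t) = S :\ i0.
  case/and3P: gd0 => D0 i0d /eqP wd.
  have [[x xT [eT eS]]|[i iS [eT eS]]] := inc_room D0 rr id0.
    rewrite {1}eS; split => //; exists x; first by rewrite eT setU11.
    by rewrite eT eS setU1K.
  have ii : i != i0 by apply: contraNneq nc => ii; rewrite eS ii eT wd.
  have iwT : i \in w @: T by rewrite eT wd !inE ii.
  split; first by rewrite eS !inE eq_sym ii.
  have /imsetP[t tT it] := iwT; exists t => //.
  have /imset_injP winj : #|w @: T| == #|T|.
    rewrite {1}eT wd cTS eS; have := cardsD1 i d0.2; have := cardsD1 i0 d0.2.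
    by rewrite iS i0d => -> /eqP; rewrite eqn_add2l.
  have -> : w @: (T :\ t) = (w @: T) :\ w t.
    apply/setP => k; rewrite !inE; apply/imsetP/andP => [[s]|[kt /imsetP[s sT ks]]].
      rewrite !inE => /andP[st sT] ->; split; last exact: imset_f.
      by apply: contraNneq st => /winj ->.
    by exists s => //; rewrite !inE sT andbT; apply: contraNneq kt => <-; rewrite ks.
  by rewrite -it eS eT wd; apply/setP => k; rewrite !inE andbCA.
have cD : #|T :\ t| = #|S :\ i0|.
  by have := cardsD1 t T; have := cardsD1 i0 S; rewrite tT iS -cTS => -> /eqP;
    rewrite eqn_add2l => /eqP.
have domS t' : dominant (T :\ t') S.
  apply/dominantP => x; have [k kS kx] := dom x; exists k => // s.
  by rewrite inE => /andP[_ /kx].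
have goodD t' : t' \in T -> good (T :\ t', S) = (w @: (T :\ t') == S :\ i0).
  move=> t'T; rewrite /good /door /= domS iS /=.
  by rewrite -cTS (cardsD1 t' T) t'T add1n eqxx.
have incD t' : inc (T :\ t', S) (T, S) by rewrite /inc /= subD1set subxx.
have injD : {in T :\ t &, injective w} by apply/imset_injP; rewrite wt cD.
have cSi i : i \notin S -> #|i |: S| = #|S|.+1 by move=> iS'; rewrite cardsU1 iS'.
have wT : w @: T = w t |: (S :\ i0) by rewrite -wt -imsetU1 setD1K.
have wti0 : w t != i0 by apply: contraNneq nc => e; rewrite wT e setD1K.
suff [a [b [ab ->]]] : exists a b, a != b /\ [set d | good d && inc d (T, S)] = [set a; b].
  by rewrite cards2 ab.
have [wtS|wtS] := boolP (w t \in S).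
  have : w t \in w @: (T :\ t) by rewrite wt !inE wti0.
  move=> /imsetP[t']; rewrite !inE => /andP[t't t'T] wtt'.
  have wt' : w @: (T :\ t') = S :\ i0.
    rewrite -wt; apply/setP => k; apply/imsetP/imsetP => -[s]; rewrite !inE => /andP[sn sT] ->.
      have [->|st] := eqVneq s t; last by exists s; rewrite // !inE st.
      by exists t'; rewrite // !inE t't.
    have [->|st'] := eqVneq s t'; last by exists s; rewrite // !inE st'.
    by exists t; rewrite // !inE eq_sym t't.
  exists (T :\ t, S), (T :\ t', S); split.
    by apply/eqP => -[] /setP/(_ t); rewrite !inE eqxx tT eq_sym t't.
  apply/setP => d; rewrite !inE; apply/andP/orP => [[gd id]|]; last first.
    by case=> /eqP ->; rewrite goodD// ?wt ?wt' eqxx incD.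
  have /and3P[D i0d /eqP wd] := gd.
  have [[x xT [eT eS]]|[i iSd [eT eS]]] := inc_room D rr id.
    have xT' : x \in T by rewrite eT setU11.
    have ed : d = (T :\ x, S) by rewrite eT eS setU1K//; case: (d).
    have : t \notin T :\ x \/ t' \notin T :\ x.
      have [tx|] := boolP (t \in T :\ x); last by left.
      right; apply/negP => t'x.
      have : #|w @: (T :\ x)| < #|T :\ x|.
        rewrite ltn_neqAle leq_imset_card andbT; apply/negP => /imset_injP inj.
        by move: t't; rewrite (inj _ _ t'x tx) ?eqxx.
      have -> : T :\ x = d.1 by rewrite ed.
      rewrite wd; have -> : #|d.1| = #|d.2 :\ i0|; last by rewrite ltnn.
      case/andP: D => _ /eqP; rewrite (cardsD1 i0) i0d => -[] //.
    by rewrite !inE tT t'T !andbT !negbK ed => -[]/eqP ->; [left|right].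
  have : #|w @: T| = #|S| by rewrite eT wd eS; have := cardsD1 i d.2; have := cardsD1 i0 d.2;
    rewrite i0d iSd => -> /eqP; rewrite eqn_add2l => /eqP.
  rewrite wT (setUidPr _) ?sub1set ?inE ?wti0//.
  by rewrite (cardsD1 i0 S) iS => /esym/eqP; rewrite eqn_leq ltnn.
exists (T :\ t, S), (T, w t |: S); split.
  by apply/eqP => -[] /setP/(_ t); rewrite !inE eqxx tT.
apply/setP => d; rewrite !inE; apply/andP/orP => [[gd id]|]; last first.
  case=> /eqP ->; first by rewrite goodD// wt eqxx.
  rewrite /good /door /inc /= cSi// cTS eqxx subxx subsetUr !inE iS orbT wT; split=> //.
  apply/and3P; split => //; last first.
    by apply/eqP/setP => k; rewrite !inE; have [->|] := eqVneq k (w t); rewrite ?wti0//= .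
  rewrite andbT; apply/dominantP => x; have [k kS kx] := dom x.
  by exists k => //; rewrite setU1r.
have /and3P[D i0d /eqP wd] := gd.
have [[x xT [eT eS]]|[i iSd [eT eS]]] := inc_room D rr id.
  left; have [xt|xt] := eqVneq x t; first by rewrite -xt eT eS setU1K//; case: (d).
  have : w t \in w @: d.1.
    by apply: imset_f; move: tT; rewrite eT !inE eq_sym (negbTE xt).
  by rewrite wd -eS !inE (negbTE wtS) andbF.
right; suff -> : w t = i by rewrite eT eS setD1K//; case: (d).
have : w t \in d.2 :\ i0 by rewrite -wd -eT imset_f.
rewrite inE => /andP[_ wtd]; apply/eqP/negPn/negP => wti; move/negP: wtS; apply.
by rewrite eS !inE wti.
Qed.

(* Double counting of incidences modulo 2: only one good door lies in an odd number of rooms. *)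
Lemma scarf : exists T S, [/\ dominant T S, S != set0, #|T| = #|S| & w @: T = S].
Proof.
have [/existsP[[T S] /andP[/andP[/= d /eqP cTS] /eqP e]]|] :=
  boolP [exists r, room r && complete r].
  exists T, S; split => //; apply/negP => /eqP S0.
  by move/dominantP: d => /(_ x0)[i]; rewrite S0 inE.
rewrite negb_exists => /forallP nc.
have : ~~ odd (\sum_(r | room r) #|[set d | good d && inc d r]|).
  elim/big_ind : _ => // [a b|r rr]; first by rewrite oddD => /negbTE-> /negbTE->.
  by apply: room_doors => //; have := nc r; rewrite rr.
have -> : \sum_(r | room r) #|[set d | good d && inc d r]| =
    \sum_(d | good d) #|[set r | room r && inc d r]|.
  under eq_bigr do rewrite -sum1_card; under [RHS]eq_bigr do rewrite -sum1_card.
  under eq_bigr do under eq_bigl do rewrite inE.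
  under [RHS]eq_bigr do under eq_bigl do rewrite inE.
  rewrite (exchange_big_dep good) /= => [|r d _ /andP[]//].
  by apply: eq_bigr => d gd; apply: eq_bigl => r; rewrite gd.
have g0 : good (set0, [set i0]).
  rewrite /good /door /= cards0 cards1 imset0 setDv inE !eqxx !andbT.
  by apply/dominantP => x; exists i0; rewrite ?inE// => t; rewrite inE.
rewrite (bigD1 _ g0) /= door_rooms0 (eq_bigr (fun=> 2)).
  by rewrite big_const iter_addn_0 oddD oddM.
move=> d /andP[gd dn]; apply: door_rooms; last by case/and3P: gd.
by apply: contra dn => /eqP/(good_set0 gd) ->.
Qed.

End Scarf.

From mathcomp Require Import all_classical all_reals all_analysis.
From mathcomp Require Import ring lra zify.

Import Order.TTheory GRing.Theory Num.Theory.
Import numFieldNormedType.Exports.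

Local Open Scope classical_set_scope.
Local Open Scope ring_scope.

(** * Brouwer's fixed point theorem *)

Section Grid.
Variables (I : finType) (m : nat) (i0 : I).
Local Open Scope nat_scope.

Definition grid := {x : {ffun I -> 'I_m.+1} | \sum_i x i == m}.

(** Lexicographic ranking: coordinate [i] first, then an arbitrary enumeration that breaks ties,
    because [scarf] needs injective rankings. *)
Definition grid_rank (i : I) (x : grid) : nat :=
  val x i * #|{: grid}| + enum_rank x.

Lemma grid_rank_inj i : injective (grid_rank i).
Proof.
move=> x y /(congr1 (modn^~ #|{: grid}|)).
rewrite /grid_rank !modnMDl !modn_small ?ltn_ord// => e.
exact/enum_rank_inj/val_inj.
Qed.

Lemma grid_rank_le i x y : grid_rank i x <= grid_rank i y -> val x i <= val y i.
Proof.
move=> /(leq_div2r #|{: grid}|); rewrite /grid_rank.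
have N0 : 0 < #|{: grid}| by rewrite (leq_ltn_trans _ (ltn_ord (enum_rank x))).
by rewrite !divnMDl// !divn_small ?ltn_ord// !addn0.
Qed.

Lemma gridW (z : I -> nat) : \sum_i z i = m -> exists x : grid, forall i, val x i = z i :> nat.
Proof.
move=> zm; have zlt i : z i < m.+1 by rewrite ltnS -zm (bigD1 i)//= leq_addr.
have sz : \sum_i (finfun (fun i => Ordinal (zlt i)) i : nat) == m.
  by rewrite -[X in _ == X]zm; apply/eqP/eq_bigr => i _; rewrite ffunE.
by exists (exist (fun x : {ffun I -> 'I_m.+1} => \sum_i x i == m) _ sz) => i; rewrite /= ffunE.
Qed.

(* Raising by one the smallest coordinates of a dominant set leaves the simplex, so these
   minima already add up to nearly [m]; hence the diameter bound. *)
Lemma scarf_grid (w : grid -> I) : exists (T : {set grid}) (S : {set I}),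
  [/\ T != finset.set0, w @: T = S,
   forall x y i, x \in T -> y \in T -> val x i <= val y i + #|I| &
   forall x i, x \in T -> i \notin S -> val x i <= #|I|].
Proof.
have [x0 _] : exists x : grid, forall i, val x i = (if i == i0 then m else 0) :> nat.
  by apply: gridW; rewrite -big_mkcond /= big_pred1_eq.
have [T [S [/dominantP dom S0 cTS wT]]] := scarf (c := grid_rank) w grid_rank_inj i0 x0.
have /set0Pn[t0 t0T] : T != finset.set0 by rewrite -card_gt0 cTS card_gt0.
pose a i := if i \in S then val [arg min_(t < t0 in T) val t i] i : nat else 0.
have aT i x : x \in T -> a i <= val x i.
  by move=> xT; rewrite /a; case: ifP => // _; case: arg_minnP => // t _; apply.
have suma : m < \sum_i a i + #|S|.
  rewrite ltnNge; apply/negP => le.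
  have /set0Pn[i1 i1S] := S0.
  pose b i := a i + (i \in S).
  have sb : \sum_i b i <= m.
    by rewrite big_split/= -[X in _ + X]big_mkcond sum1_card.
  (* This point exceeds the minima of [T] at every index of [S], against dominance; the surplus
     placed on [i1] brings the sum up to [m]. *)
  have [|z zE] := @gridW (fun i => b i + (i == i1) * (m - \sum_i b i)).
    have e1 : \sum_i (i == i1) = 1.
      by rewrite (bigD1 i1)//= eqxx big1// => i /negbTE ->.
    by rewrite big_split /= -big_distrl /= e1 mul1n subnKC.
  have [i iS iz] := dom z.
  have /iz/grid_rank_le : [arg min_(t < t0 in T) val t i] \in T by case: arg_minnP.
  by rewrite zE /b /a iS addn1 addSn ltnNge leq_addr.
have leI : #|S| <= #|I| by exact: max_card.
have aI i x : x \in T -> val x i <= a i + #|I|.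
  move=> xT; have : \sum_i val x i = m by apply/eqP; case: (x).
  rewrite (bigD1 i) //= => xm.
  have : \sum_(j | j != i) a j <= \sum_(j | j != i) val x j by apply: leq_sum => j _; exact: aT.
  move: suma xm leI; rewrite (bigD1 i) //=.
  set u := \sum_(j | _) _; set v := \sum_(j | _) _.
  move: #|S| #|I| u v (a i) (nat_of_ord _); lia.
exists T, S; split => //.
- by apply/set0Pn; exists t0.
- by move=> x y i xT yT; apply: (leq_trans (aI i x xT)); rewrite leq_add2r aT.
- by move=> x i xT iS; have := aI i x xT; rewrite /a (negbTE iS).
Qed.

End Grid.

(** * Limits along ultrafilters *)

Section Ultra.
Context {R : realType}.

(** A cluster point of an ultrafilter is a limit, since [G] contains the preimage of each
    neighbourhood or its complement. *)
Lemma ultra_compact_cvg (T : Type) (U : topologicalType) (G : set_system T)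
    (h : T -> U) (K : set U) :
  UltraFilter G -> compact K -> (\forall x \near G, K (h x)) -> exists l : U, h @ G --> l.
Proof.
move=> UG cK hK; have [l [_ cl]] := cK (h @ G) _ hK.
exists l => N lN; have [//|hN] := in_ultra_setVsetC (h @^-1` N) UG.
by have [x []] := cl (~` N) N hN lN.
Qed.

Lemma ultra_bounded_cvg (T : Type) (G : set_system T) (h : T -> R) (c : R) :
  UltraFilter G -> (\forall x \near G, `|h x| <= c) -> exists l : R, h @ G --> l.
Proof.
move=> UG hc; apply: (ultra_compact_cvg UG (@segment_compact R (- c) c)).
by apply: filterS hc => x /=; rewrite in_itv /= -ler_norml.
Qed.

(** If a neighbourhood [N] failed, [F] and the complement of the preimage of [N] would generate a
    proper filter, and an ultrafilter containing it could not send [h] to [l]. *)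
Lemma ultra_cvg (T : Type) (U : topologicalType) (F : set_system T) (h : T -> U) (l : U) :
  ProperFilter F -> (forall G, UltraFilter G -> F `<=` G -> h @ G --> l) -> h @ F --> l.
Proof.
move=> PF H N lN; apply: contrapT => hN.
have PG : ProperFilter (filter_from F (fun A => A `&` ~` (h @^-1` N))).
  apply: filter_from_proper.
    apply: filter_from_filter; first by exists setT; exact: filterT.
    by move=> A B FA FB; exists (A `&` B); [exact: filterI|move=> x [[? ?] ?]].
  move=> A FA; apply: contrapT => /set0P/negP; rewrite negbK => /eqP A0.
  apply: hN; suff : A `<=` h @^-1` N by move=> sA; exact: filterS sA FA.
  move=> x Ax; apply: contrapT => nx.
  by have : (A `&` ~` (h @^-1` N)) x by []; rewrite A0.
have [G [UG sG]] := ultraFilterLemma PG.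
have sFG : F `<=` G by move=> A FA; apply: sG; exists A => // x [].
have G1 : G (h @^-1` N) by exact: (H G UG sFG N lN).
have G2 : G (~` (h @^-1` N)) by apply: sG; exists setT => [|x []//]; exact: filterT.
by have [x []] := filter_ex (filterI G1 G2).
Qed.

End Ultra.

Section Limits.
Context {R : realType} {T : Type} {F : set_system T} {FF : ProperFilter F}.

Lemma cvg_ler (f g : T -> R) (a b : R) : f @ F --> a -> g @ F --> b ->
  (\forall x \near F, f x <= g x) -> a <= b.
Proof.
move=> fa gb fg; rewrite -subr_ge0; apply: (cvgr_to_ge (cvgB gb fa)).
by apply: filterS fg => x /=; rewrite subr_ge0.
Qed.

Lemma cvg_sum_ord (V : normedModType R) (I : finType) (P : pred I) (f : I -> T -> V) (a : I -> V) :
  (forall i, P i -> f i x @[x --> F] --> a i) ->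
  \sum_(i | P i) f i x @[x --> F] --> \sum_(i | P i) a i.
Proof. by move=> H; apply: cvg_big => //; exact: add_continuous. Qed.

Lemma cvg_dist_le (V : normedModType R) (f : T -> V) (a : V) (g : T -> R) :
  (\forall x \near F, `|f x - a| <= g x) -> g @ F --> (0 : R) -> f @ F --> a.
Proof.
move=> fg g0; apply/cvgrPdist_le => e e0.
have ge : \forall x \near F, g x <= e by exact: (cvgr_le _ g0).
apply: filterS2 fg ge => x fgx gx.
by rewrite distrC (le_trans fgx).
Qed.

Lemma cvg0_dist (V : normedModType R) (f : T -> V) (a : V) :
  f @ F --> a -> `|f x - a| @[x --> F] --> (0 : R).
Proof. by move=> fa; apply/norm_cvg0P/subr_cvg0. Qed.

End Limits.

Section Brouwer.
Context {R : realType} {I : finType}.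
Implicit Types (l : I -> R) (F : (I -> R) -> I -> R).

Definition simplex l := (forall i, 0 <= l i) /\ \sum_i l i = 1.

Lemma simplex_le1 l i : simplex l -> l i <= 1.
Proof. by case=> l0 <-; rewrite (bigD1 i)//= lerDl sumr_ge0. Qed.

Lemma simplex_inh l : simplex l -> exists i : I, True.
Proof.
case=> _ l1; apply: contrapT => nI; have := oner_neq0 R.
by rewrite -l1 big1 ?eqxx// => i _; case: nI; exists i.
Qed.

(** A grid point is labelled by a coordinate that [F] does not decrease; one exists because both
    coordinate sums are 1. For [i] among the labels of Scarf's set, [y i] is a point with label [i];
    for other [i] any point of the set will do, its coordinate [i] being at most
    [#|I| / (m + 1)]. *)
Lemma brouwer_approx F (m : nat) (i0 : I) : (forall l, simplex l -> simplex (F l)) ->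
  exists (x : I -> R) (y : I -> I -> R), [/\ simplex x, forall i, simplex (y i),
   forall i k, `|x k - y i k| <= #|I|%:R / m.+1%:R &
   forall i, y i i <= F (y i) i + #|I|%:R / m.+1%:R].
Proof.
move=> FS; pose pt (x : grid I m.+1) i : R := (val x i : nat)%:R / m.+1%:R.
have ptS x : simplex (pt x).
  split=> [i|]; first by rewrite divr_ge0.
  rewrite -mulr_suml -natr_sum (eqP (valP x)) divff// pnatr_eq0//.
have wex x : exists i, pt x i <= F (pt x) i.
  apply: contrapT => /forallNP nx.
  have [_ s1] := ptS x; have [_ s2] := FS _ (ptS x).
  have : \sum_i F (pt x) i < \sum_i pt x i; last by rewrite s1 s2 ltxx.
  apply: ltr_sum; first by apply/hasP; exists i0; rewrite ?mem_index_enum.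
  by move=> i _; rewrite ltNge; apply/negP.
pose w x := projT1 (cid (wex x)).
have wP x : pt x (w x) <= F (pt x) (w x) by rewrite /w; case: cid.
have [T [S [T0 wT dT dS]]] := scarf_grid i0 w.
have /set0Pn[t tT] := T0.
have near x y k : x \in T -> y \in T -> `|pt x k - pt y k| <= #|I|%:R / m.+1%:R.
  move=> xT yT; rewrite /pt -mulrBl normrM [`|_^-1|]ger0_norm ?invr_ge0//.
  rewrite ler_wpM2r ?invr_ge0// ler_norml lerBlDr lerNl opprB lerBlDr -!natrD !ler_nat.
  by rewrite addnC dT//= addnC dT.
have ex i : exists y, [/\ simplex y, forall k, `|pt t k - y k| <= #|I|%:R / m.+1%:R &
    y i <= F y i + #|I|%:R / m.+1%:R].
  have [iS|iS] := boolP (i \in S).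
    move: iS; rewrite -wT => /imsetP[x xT ->].
    exists (pt x); split => // [k|]; first exact: near.
    by rewrite (le_trans (wP x))// lerDl divr_ge0.
  exists (pt t); split => //[k|]; first by rewrite subrr normr0 divr_ge0.
  rewrite -[leLHS]add0r lerD//; first by case: (FS _ (ptS t)).
  by rewrite ler_wpM2r ?invr_ge0// ler_nat dS.
have [y yP] := choice ex.
by exists (pt t), y; split => // [i|i k|i]; have [] := yP i.
Qed.

(** Along an ultrafilter all approximating points merge into one [l] with [l i <= F l i] for every
    [i], and equal sums force equality. Continuity is stated along arbitrary filters on [nat]
    because it is used along that ultrafilter. *)
Lemma brouwer F (l0 : I -> R) : simplex l0 ->
  (forall l, simplex l -> simplex (F l)) ->
  (forall (G : set_system nat) (L : nat -> I -> R) l, ProperFilter G ->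
    (forall n, simplex (L n)) -> simplex l ->
    (forall i, L n i @[n --> G] --> l i) -> forall i, F (L n) i @[n --> G] --> F l i) ->
  exists2 l, simplex l & F l = l.
Proof.
move=> /simplex_inh[i0 _] FS Fc.
have [x xP] := choice (fun m => @brouwer_approx F m i0 FS).
have [y yP] := choice xP.
have [G [UG sG]] := ultraFilterLemma (@eventually_filter).
have xS m : simplex (x m) by have [] := yP m.
have yS m i : simplex (y m i) by have [] := yP m.
have /choice[l lP] : forall i, exists l : R, x m i @[m --> G] --> l.
  move=> i; apply: (@ultra_bounded_cvg _ _ G _ 1); apply: nearW => m.
  by rewrite ger0_norm ?simplex_le1//; case: (xS m).
have e0 : #|I|%:R / m.+1%:R @[m --> G] --> (0 : R).
  apply: cvg_trans (cvg_app _ sG) _.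
  by rewrite -[X in _ --> X](mulr0 #|I|%:R); apply: cvgMl_tmp; exact: cvg_harmonic.
have lS : simplex l.
  split=> [i|].
    by apply: (cvgr_to_ge (lP i)); apply: nearW => m; case: (xS m).
  have cs : \sum_i x m i @[m --> G] --> \sum_i l i.
    by apply: (@cvg_sum_ord _ _ _ _ R^o) => i _; exact: lP.
  have c1 : \sum_i x m i @[m --> G] --> (1 : R).
    rewrite (_ : (fun m => _) = fun=> 1); first exact: cvg_cst.
    by apply/funext => m; case: (xS m).
  exact: (cvg_unique (@norm_hausdorff _ R^o) cs c1).
have yl i k : y m i k @[m --> G] --> l k.
  have c0 : `|x m k - l k| + #|I|%:R / m.+1%:R @[m --> G] --> (0 : R).
    rewrite -[X in _ --> X](addr0 0); apply: cvgD e0.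
    exact: (cvg0_dist (V := R^o) (lP k)).
  apply: (cvg_dist_le (V := R^o) _ c0); apply: nearW => m.
  have [_ _ /(_ i k) xy _] := yP m.
  rewrite (le_trans (ler_distD (x m k) _ _))// addrC lerD// distrC.
  exact: xy.
exists l => //; apply/funext => i.
have Fge k : l k <= F l k.
  have Fk : F (y m k) k @[m --> G] --> F l k by apply: (Fc G (y^~ k)) => //.
  rewrite -[leRHS]addr0; apply: (cvg_ler (yl k k) (cvgD Fk e0)).
  by apply: nearW => m; case: (yP m).
have [_ s1] := lS; have [_ s2] := FS _ lS.
apply/eqP; rewrite eq_le Fge andbT.
move: s1 s2; rewrite (bigD1 i)//= (bigD1 (F := F l) i)//=.
have : \sum_(k | k != i) l k <= \sum_(k | k != i) F l k by apply: ler_sum => k _.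
lra.
Qed.

End Brouwer.

(** * Hahn-Banach and weak compactness *)

Section RealInf.
Context {R : realType} {T : Type} (P : set T) (h : T -> R) (b : R).
Hypothesis hb : forall t, P t -> b <= h t.

Lemma inf_image_le t : P t -> inf (h @` P) <= h t.
Proof. by move=> Pt; apply: ge_inf; [exists b => _ [s Ps <-]; exact: hb|exists t]. Qed.

Lemma inf_image_ge (c : R) : P !=set0 -> (forall t, P t -> c <= h t) -> c <= inf (h @` P).
Proof. by case=> t Pt ch; apply: lb_le_inf; [exists (h t), t|move=> _ [s Ps <-]; exact: ch]. Qed.

End RealInf.

Section HahnBanach.
Context {R : realType} {V : lmodType R}.
Implicit Types p q : V -> R.

Definition sublinear p := (forall x y, p (x + y) <= p x + p y) /\
  (forall t x, 0 <= t -> p (t *: x) = t * p x).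

Lemma sublinear0 p : sublinear p -> p 0 = 0.
Proof. by case=> _ /(_ 0 0 (lexx _)); rewrite scaler0 mul0r. Qed.

Lemma sublinearN p x : sublinear p -> - p (- x) <= p x.
Proof. by move=> sp; rewrite lerNl -subr_ge0 opprK addrC -(sublinear0 sp) -(subrr x) (sp.1 x). Qed.

(** Zorn's lemma for the reversed pointwise order: a chain is bounded by its pointwise infimum,
    which is finite because [- p (- x) <= q x] for each sublinear [q] below [p]. *)
Lemma hahn_banach_minimal p : sublinear p ->
  exists q, [/\ sublinear q, forall x, q x <= p x &
    forall q', sublinear q' -> (forall x, q' x <= q x) -> q' = q].
Proof.
move=> sp; pose T := {q : V -> R | sublinear q /\ forall x, q x <= p x}.
pose r (a b : T) : bool := `[< forall x, sval b x <= sval a x >].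
have [||||[q [sq qp]] qm] := @Zorn T r.
- by move=> t; apply/asboolP.
- move=> a b c /asboolP ab /asboolP bc; apply/asboolP => x.
  exact: le_trans (bc x) (ab x).
- move=> [a a'] [b b'] /asboolP /= ab /asboolP /= ba.
  have e : a = b by apply/funext => x; apply/le_anti; rewrite ab ba.
  by subst b; congr exist; exact: Prop_irrelevance.
- move=> A tA; have [[a0 Aa0]|A0] := pselect (A !=set0); last first.
    by exists (exist _ p (conj sp (fun x => lexx _))) => s As; case: A0; exists s.
  pose m x := inf ((fun a : T => sval a x) @` A).
  have lb x a : A a -> - p (- x) <= sval a x.
    move=> _; case: a => a [sa ap] /=.
    by apply: le_trans (sublinearN x sa); rewrite lerN2.
  have mle x a : A a -> m x <= sval a x by move=> Aa; exact: (inf_image_le (lb x)).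
  have mge x (c : R) : (forall a, A a -> c <= sval a x) -> c <= m x.
    by move=> H; apply: inf_image_ge => //; exists a0.
  have sm : sublinear m.
    split=> [x y|t x t0].
      rewrite -lerBlDr; apply/mge => a Aa; rewrite lerBlDr -lerBlDl.
      apply/mge => b Ab; rewrite lerBlDl.
      have [/asboolP ab|/asboolP ba] := tA _ _ Aa Ab.
        apply: (le_trans (mle _ _ Ab)); apply: (le_trans ((svalP b).1.1 x y)).
        by rewrite lerD2r.
      apply: (le_trans (mle _ _ Aa)); apply: (le_trans ((svalP a).1.1 x y)).
      by rewrite lerD2l.
    move: t0; rewrite le_eqVlt => /predU1P[<-|t0].
      rewrite scale0r mul0r; apply/le_anti/andP; split.
        by apply: (le_trans (mle _ _ Aa0)); rewrite (sublinear0 (svalP a0).1).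
      by apply/mge => a _; rewrite (sublinear0 (svalP a).1).
    apply/le_anti/andP; split.
      rewrite -ler_pdivrMl//; apply/mge => a Aa; rewrite ler_pdivrMl//.
      by apply: (le_trans (mle _ _ Aa)); rewrite (svalP a).1.2// ltW.
    apply/mge => a Aa; rewrite (svalP a).1.2 ?(ltW t0)// ler_pM2l//.
    exact: mle.
  have mp x : m x <= p x by apply: (le_trans (mle _ _ Aa0)); exact: (svalP a0).2.
  by exists (exist _ m (conj sm mp)) => s As; apply/asboolP => x; exact: mle.
exists q; split => // q' sq' q'q.
have q'p x : q' x <= p x by exact: le_trans (q'q x) (qp x).
by have /(congr1 sval) := qm (exist _ q' (conj sq' q'p)) (introT (asboolP _) q'q).
Qed.

(** A minimal sublinear [q] is additive: the infimum [Q z] of [q (z + t y) - t q y] over [t >= 0] is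
    sublinear and below [q], hence equal to [q], and [t = 1] gives [q x + q y <= q (x + y)]. *)
Lemma hahn_banach p : sublinear p ->
  exists q, (forall a x y, q (a *: x + y) = a * q x + q y) /\ forall x, q x <= p x.
Proof.
move=> /hahn_banach_minimal[q [sq qp qm]]; exists q; split => //.
have addq x y : q (x + y) = q x + q y.
  apply/le_anti; rewrite sq.1 /= -lerBrDr.
  pose Q x := inf ((fun t => q (x + t *: y) - t * q y) @` [set t | 0 <= t]).
  have lb z t : 0 <= t -> - q (- z) <= q (z + t *: y) - t * q y.
    move=> t0; rewrite lerBrDr addrC -sq.2// lerBlDr.
    by rewrite (le_trans _ (sq.1 _ _))// addrAC subrr add0r.
  have Qle z t : 0 <= t -> Q z <= q (z + t *: y) - t * q y by exact: (inf_image_le (lb z)).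
  have Qge z c : (forall t, 0 <= t -> c <= q (z + t *: y) - t * q y) -> c <= Q z.
    by move=> H; apply: inf_image_ge => //; exists 0 => /=.
  have Qq z : Q z <= q z.
    by rewrite (le_trans (Qle z 0 _))// scale0r mul0r subr0 addr0.
  rewrite -{1}(qm Q)//; first by rewrite (le_trans (Qle x 1 _))// scale1r mul1r.
  split=> [u v|t u t0].
    rewrite -lerBlDr; apply/Qge => s s0; rewrite lerBlDr -lerBlDl.
    apply/Qge => t t0; rewrite lerBlDl.
    rewrite (le_trans (Qle _ (s + t) _)) ?addr_ge0// scalerDl mulrDl addrACA.
    have := sq.1 (u + s *: y) (v + t *: y); lra.
  move: t0; rewrite le_eqVlt => /predU1P[<-|t0].
    rewrite scale0r mul0r; apply/le_anti/andP; split.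
      by rewrite (le_trans (Qq _))// (sublinear0 sq).
    by apply/Qge => s s0; rewrite add0r sq.2// subrr.
  apply/le_anti/andP; split.
    rewrite -ler_pdivrMl//; apply/Qge => s s0; rewrite ler_pdivrMl//.
    rewrite (le_trans (Qle _ (t * s) _)) ?mulr_ge0 ?(ltW t0)//.
    by rewrite -scalerA -scalerDr sq.2 ?(ltW t0)// mulrBr mulrA.
  apply/Qge => s s0; rewrite -ler_pdivlMl//.
  rewrite (le_trans (Qle _ (t^-1 * s) _)) ?mulr_ge0 ?invr_ge0 ?(ltW t0)//.
  rewrite ler_pdivlMl// mulrBr -(sq.2 _ _ (ltW t0)) scalerDr scalerA !mulrA divff ?gt_eqF//.
  by rewrite !mul1r.
have oppq x : q (- x) = - q x.
  by apply/eqP; rewrite -subr_eq0 opprK addrC -addq subrr (sublinear0 sq).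
move=> a x y; rewrite addq; congr (_ + _).
have [a0|a0] := leP 0 a; first exact: sq.2.
by rewrite -[a]opprK scaleNr oppq sq.2 ?oppr_ge0 ?(ltW a0)// !mulNr.
Qed.

End HahnBanach.

Lemma mk_dual {R : realType} {V : normedModType R} (h : V -> R) (c : R) :
  (forall a x y, h (a *: x + y) = a * h x + h y) -> (forall x, `|h x| <= c * `|x|) ->
  exists g : dual V, forall x, g x = h x.
Proof.
move=> hl hc; have hP : (h : V -> R^o) \in @dual_pred R V.
  apply/asboolP; split; first exact: hl.
  move=> x; apply: (cvg_dist_le (g := fun y => c * `|y - x|)).
    apply: nearW => y; rewrite (_ : h y - h x = h (y - x)) ?hc//.
    have -> : y - x = -1 *: x + y by rewrite scaleN1r addrC.
    by rewrite hl mulN1r addrC.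
  rewrite -[X in _ --> X](mulr0 c); apply: cvgMl_tmp.
  exact: cvg0_dist.
by exists (Dual hP).
Qed.

(** * Subgradients, separation and weak limits *)

Section Dual.
Context {R : realType} {V : normedModType R}.
Implicit Types (x : V) (g : dual V).

Definition convexf (phi : V -> R) := forall x y t, 0 <= t -> t <= 1 ->
  phi (t *: x + (1 - t) *: y) <= t * phi x + (1 - t) * phi y.

Lemma dualB g x y : g (x - y) = g x - g y. Proof. exact: linearB. Qed.

Lemma dualN g x : g (- x) = - g x. Proof. exact: linearN. Qed.

Lemma dualZ g (t : R) x : g (t *: x) = t * g x. Proof. exact: linearZ. Qed.

Lemma dual_sum (I : finType) (F : I -> V) g : g (\sum_i F i) = (\sum_i (g (F i) : R)) :> R.
Proof. exact: linear_sum. Qed.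

Lemma dual0 g : g 0 = 0. Proof. exact: linear0. Qed.

Lemma dual_le g x : `|g x| <= `|g| * `|x|.
Proof.
have [->|x0] := eqVneq x 0; first by rewrite linear0 !normr0 mulr0.
have nx : 0 < `|x| by rewrite normr_gt0.
rewrite -ler_pdivrMr//.
have /(dual_le_opnorm g) : Num.norm (`|x|^-1 *: x) <= 1.
  by rewrite normrZ normfV normr_id mulVf ?normr_eq0.
by rewrite linearZ /= normrM normfV normr_id mulrC.
Qed.

Lemma dual_norm_le g (c : R) : 0 <= c -> (forall x, `|g x| <= c * `|x|) -> `|g| <= c.
Proof.
move=> c0 gc; apply: dual_opnorm_le => x x1; apply: (le_trans (gc x)).
by rewrite ler_piMr.
Qed.

Lemma dual_cvg (T : Type) (F : set_system T) (FF : Filter F) (h : T -> V) (l : V) g :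
  h @ F --> l -> g (h t) @[t --> F] --> g l.
Proof. by move=> hl; apply: (cvg_comp _ _ hl); exact: dual_continuous. Qed.

(** The one-sided directional derivative [p] at [x0] is sublinear, and any linear functional below
    it is a subgradient. The Lipschitz bound makes [p] finite and the functional continuous. *)
Lemma convex_subgradient (phi : V -> R) (c : R) (x0 : V) : convexf phi ->
  (forall x y, phi x - phi y <= c * `|x - y|) ->
  exists g : dual V, forall v, g (v - x0) <= phi v - phi x0.
Proof.
move=> cphi lphi.
pose D v t := (phi (x0 + t *: v) - phi x0) / t.
pose p v := inf (D v @` [set t | 0 < t]).
have lb v t : 0 < t -> - (c * `|v|) <= D v t.
  move=> t0; rewrite /D ler_pdivlMr// mulNr lerNl opprB.
  apply: (le_trans (lphi _ _)); rewrite opprD addrA subrr add0r normrN normrZ gtr0_norm//.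
  by rewrite mulrCA mulrC.
have ple v t : 0 < t -> p v <= D v t by exact: (inf_image_le (lb v)).
have pge v b : (forall t, 0 < t -> b <= D v t) -> b <= p v.
  by move=> H; apply: inf_image_ge => //; exists 1 => /=.
have pc v : p v <= c * `|v|.
  apply: (le_trans (ple v 1 ltr01)); rewrite /D scale1r divr1.
  by apply: (le_trans (lphi _ _)); rewrite addrAC subrr add0r.
have sp : sublinear p.
  split=> [v w|t v t0].
    rewrite -lerBlDr; apply/pge => s s0; rewrite lerBlDr -lerBlDl.
    apply/pge => t t0; rewrite lerBlDl.
    have st0 : 0 < s + t by rewrite addr_gt0.
    (* With [u = st / (s + t)], the point [x0 + u (v + w)] is the convex combination of [x0 + s v]
       and [x0 + t w] with weights [t / (s + t)] and [s / (s + t)]. *)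
    have u0 : 0 < s * t / (s + t) by rewrite divr_gt0 ?mulr_gt0.
    apply: (le_trans (ple _ _ u0)); rewrite /D ler_pdivrMr//.
    have := cphi (x0 + s *: v) (x0 + t *: w) (t / (s + t)).
    have -> : 1 - t / (s + t) = s / (s + t) by field; rewrite gt_eqF.
    have -> : t / (s + t) *: (x0 + s *: v) + s / (s + t) *: (x0 + t *: w) =
        x0 + (s * t / (s + t)) *: (v + w).
      rewrite !scalerDr !scalerA addrACA -scalerDl.
      have -> : t / (s + t) + s / (s + t) = 1 by field; rewrite gt_eqF.
      rewrite scale1r; congr (_ + (_ *: _ + _ *: _)); by field; rewrite gt_eqF.
    rewrite divr_ge0 ?(ltW t0) ?(ltW st0)// => /(_ isT).
    rewrite ler_pdivrMr// mul1r lerDr (ltW s0) => /(_ isT) H.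
    have -> : ((phi (x0 + s *: v) - phi x0) / s + (phi (x0 + t *: w) - phi x0) / t) *
        (s * t / (s + t))
      = t / (s + t) * phi (x0 + s *: v) + s / (s + t) * phi (x0 + t *: w) - phi x0.
      by field; rewrite !gt_eqF.
    by rewrite lerD2r.
  move: t0; rewrite le_eqVlt => /predU1P[<-|t0].
    rewrite scale0r mul0r; apply/le_anti/andP; split.
      by apply: (le_trans (pc _)); rewrite normr0 mulr0.
    by apply/pge => s s0; rewrite /D scaler0 addr0 subrr mul0r.
  apply/le_anti/andP; split.
    rewrite -ler_pdivrMl//; apply/pge => s s0; rewrite ler_pdivrMl//.
    have st0 : 0 < s / t by rewrite divr_gt0.
    apply: (le_trans (ple _ _ st0)); rewrite /D scalerA divfK ?gt_eqF//.
    by rewrite invfM invrK mulrA mulrC mulrA.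
  apply/pge => s s0; rewrite -ler_pdivlMl//.
  have st0 : 0 < s * t by rewrite mulr_gt0.
  apply: (le_trans (ple _ _ st0)); rewrite /D scalerA.
  by rewrite invfM mulrA [leRHS]mulrC.
have [q [ql qp]] := hahn_banach sp.
have qN v : q (- v) = - q v.
  have := ql (-1) v 0; rewrite addr0 scaleN1r mulN1r => ->.
  have := ql 1 0 0; rewrite scale1r addr0 mul1r => /eqP.
  by rewrite -subr_eq0 opprD addrA subrr add0r oppr_eq0 => /eqP ->; rewrite addr0.
have [g gq] : exists g : dual V, forall v, g v = q v.
  apply: (@mk_dual _ _ q c) => // v; rewrite ler_norml (le_trans (qp v) (pc v)) andbT.
  by rewrite lerNl -qN (le_trans (qp _))// (le_trans (pc _))// normrN.
exists g => v; rewrite gq (le_trans (qp _))// (le_trans (ple _ 1 ltr01))// /D.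
by rewrite scale1r divr1 (addrC x0) subrK.
Qed.

(** A subgradient of the norm at [x]: comparison with [x + v] bounds its norm, comparison with [0]
    gives its value at [x]. *)
Lemma norming_functional x : exists2 g : dual V, `|g| <= 1 & g x = `|x|.
Proof.
have [||g gP] := @convex_subgradient (fun v => `|v|) 1 x.
- move=> u v t t0 t1; rewrite (le_trans (ler_normD _ _))// !normrZ ger0_norm//.
  by rewrite ger0_norm// subr_ge0.
- by move=> u v; rewrite mul1r lerB_dist.
have gle v : g v <= `|v|.
  have := gP (x + v); rewrite addrAC subrr add0r => /le_trans; apply.
  by rewrite lerBlDl ler_normD.
exists g.
  apply: dual_norm_le => // v; rewrite mul1r ler_norml gle andbT.
  by rewrite lerNl -linearN (le_trans (gle _))// normrN.
apply/le_anti; rewrite gle /=.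
by have := gP 0; rewrite sub0r linearN normr0 sub0r lerN2.
Qed.

Lemma dual_separate x : (forall g : dual V, g x = 0) -> x = 0.
Proof.
by move=> gx; have [g _] := norming_functional x; rewrite gx => /esym/eqP;
  rewrite normr_eq0 => /eqP.
Qed.

Lemma convex_set_conv (C : set V) x y (t : R) : convex_set C -> C x -> C y ->
  0 <= t -> t <= 1 -> C (t *: x + (1 - t) *: y).
Proof.
move=> cC Cx Cy t0 t1; have tI : 0 <= t <= 1 by rewrite t0.
have := cC x y (Itv01 t0 t1) (mem_set Cx) (mem_set Cy).
by rewrite inE.
Qed.

(** A subgradient at [x] of the distance to [C] separates, with gap [dist x], because the distance
    vanishes on [C]. *)
Lemma convex_separation (C : set V) x (e : R) : convex_set C -> C !=set0 -> 0 < e ->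
  (forall c, C c -> e <= `|x - c|) ->
  exists (g : dual V) (d : R), 0 < d /\ forall c, C c -> g c + d <= g x.
Proof.
move=> cC C0 e0 eP.
pose dist v := inf ((fun c => `|v - c|) @` C).
have lb v c : C c -> 0 <= `|v - c| by [].
have dle v c : C c -> dist v <= `|v - c| by exact: (inf_image_le (lb v)).
have dge v b : (forall c, C c -> b <= `|v - c|) -> b <= dist v.
  by move=> H; apply: inf_image_ge.
have [||g gP] := @convex_subgradient dist 1 x.
- move=> u v t t0 t1.
  have t1' : 0 <= 1 - t by rewrite subr_ge0.
  move: (t0); rewrite le_eqVlt => /predU1P[<-|tp].
    by rewrite scale0r mul0r !add0r subr0 scale1r mul1r.
  move: t1'; rewrite le_eqVlt => /predU1P[te|tp'].
    by rewrite -te (_ : t = 1) ?scale1r ?scale0r ?mul1r ?mul0r ?addr0//; apply/eqP;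
      rewrite -subr_eq0 -opprB -te oppr0.
  rewrite -lerBlDr -ler_pdivrMl//; apply/dge => c Cc; rewrite ler_pdivrMl//.
  rewrite lerBlDr -lerBlDl -ler_pdivrMl//; apply/dge => c' Cc'; rewrite ler_pdivrMl//.
  rewrite lerBlDl (le_trans (dle _ _ (convex_set_conv cC Cc Cc' t0 t1)))//.
  rewrite opprD addrACA -!scalerBr (le_trans (ler_normD _ _))//.
  by rewrite !normrZ !gtr0_norm.
- move=> u v; rewrite lerBlDr -lerBlDl; apply/dge => c Cc.
  rewrite lerBlDl (le_trans (dle _ _ Cc))// mul1r.
  by rewrite (le_trans _ (ler_normD _ _))// addrA subrK.
exists g, (dist x); split.
  by apply: (lt_le_trans e0); exact: dge.
move=> c Cc; rewrite -lerBrDl -opprB -linearB lerNr.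
apply: (le_trans (gP c)); rewrite -[leRHS]add0r lerD2r.
by rewrite (le_trans (dle _ _ Cc))// subrr normr0.
Qed.

Lemma closed_convex_separation (C : set V) x : closed C -> convex_set C -> C !=set0 -> ~ C x ->
  exists (g : dual V) (d : R), 0 < d /\ forall c, C c -> g c + d <= g x.
Proof.
move=> clC cC C0 nCx.
suff [e e0 eP] : exists2 e : R, 0 < e & forall c, C c -> e <= `|x - c|.
  exact: convex_separation cC C0 e0 eP.
apply: contrapT => nE; apply: nCx; apply: clC => N /nbhs_ballP[e /= e0 eN].
apply: contrapT => CN; apply: nE; exists e => // c Cc.
rewrite leNgt; apply/negP => xc; apply: CN; exists c; split => //.
by apply: eN; rewrite -ball_normE.
Qed.

(** By linearity no functional can exceed, at a weighted mean, its values at all the [z i] by a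
    fixed amount; separation thus spares an induction on the number of points. *)
Lemma closed_convex_sum (C : set V) (I : finType) (l : I -> R) (z : I -> V) :
  closed C -> convex_set C -> simplex l -> (forall i, C (z i)) -> C (\sum_i l i *: z i).
Proof.
move=> clC cC [l0 l1] Cz; apply: contrapT => nC.
have [i _] := simplex_inh (conj l0 l1).
have [|g [d [d0 gd]]] := closed_convex_separation clC cC _ nC.
  by exists (z i).
have : \sum_i l i * (g (z i) + d) <= \sum_i l i * g (\sum_i l i *: z i).
  by apply: ler_sum => k _; rewrite ler_wpM2l// gd.
rewrite -mulr_suml l1 mul1r; under eq_bigr do rewrite mulrDr.
rewrite big_split/= -mulr_suml l1 mul1r linear_sum /=.
under [X in _ <= X]eq_bigr do rewrite linearZ /=.
by rewrite gerDl leNgt d0.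
Qed.

(** Mazur's theorem: the gap of a separating functional would survive in the weak limit. *)
Lemma closed_convex_weak (T : Type) (F : set_system T) (PF : ProperFilter F) (C : set V)
    (h : T -> V) x : closed C -> convex_set C -> (\forall t \near F, C (h t)) ->
  (forall g : dual V, g (h t) @[t --> F] --> g x) -> C x.
Proof.
move=> clC cC Ch hx; apply: contrapT => nC.
have [t0 Ct0] := filter_ex Ch.
have [|g [d [d0 gd]]] := closed_convex_separation clC cC _ nC; first by exists (h t0).
have : g x <= g x - d.
  by apply: (cvgr_to_le (hx g)); apply: filterS Ch => t /gd; rewrite lerBrDr.
by rewrite lerBrDr gerDl leNgt d0.
Qed.

(** The limits of [g (h t)] along the ultrafilter depend linearly and boundedly on [g], so
    reflexivity represents them by a point. *)
Lemma reflexive_ultra (T : Type) (G : set_system T) (UG : UltraFilter G) (h : T -> V) (c : R) :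
  reflexive_space V -> (\forall t \near G, `|h t| <= c) ->
  exists x, forall g : dual V, g (h t) @[t --> G] --> g x.
Proof.
move=> refl hc.
have c0 : 0 <= c by have [t] := filter_ex hc; apply: le_trans.
have gc g : \forall t \near G, `|g (h t)| <= `|g| * c.
  by apply: filterS hc => t hc; rewrite (le_trans (dual_le _ _))// ler_wpM2l.
have /choice[Phi PhiP] : forall g : dual V, exists l : R, g (h t) @[t --> G] --> l.
  by move=> g; exact: ultra_bounded_cvg UG (gc g).
have PhiU g l : g (h t) @[t --> G] --> l -> Phi g = l.
  by move=> gl; exact: (cvg_unique (@norm_hausdorff _ R^o) (PhiP g) gl).
have [||Psi PsiE] := @mk_dual _ (dual V) Phi c.
- move=> a g g'; apply: PhiU.
  exact: (cvgD (cvgMl_tmp (a := a) (PhiP g)) (PhiP g')).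
- move=> g; apply: (cvgr_to_le (cvg_norm (PhiP g))).
  by apply: filterS (gc g) => t; rewrite mulrC.
by have [x xP] := refl Psi; exists x => g; rewrite -xP PsiE.
Qed.

End Dual.

(** * Weakly convergent subsequences of bounded sequences *)

Section WeakCompactness.
Context {R : realType} {V : normedModType R}.
Variables (u : nat -> V) (c : R).
Hypothesis uc : forall n, `|u n| <= c.

Let lc n (a : nat -> R) := \sum_(i < n) a i *: u i.

Let lc_widen n m a : lc n a = lc (n + m) (fun i => if (i < n)%N then a i else 0).
Proof.
rewrite /lc big_split_ord /= [X in _ = _ + X]big1 ?addr0 => [|i _].
  by apply: eq_bigr => i _; rewrite ltn_ord.
by rewrite ltnNge leq_addr /= scale0r.
Qed.

Let span := [set v | exists n a, v = lc n a].

Let span_add v w (s t : R) : span v -> span w -> span (s *: v + t *: w).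
Proof.
move=> [n [a ->]] [m [b ->]].
rewrite (lc_widen n m a) (lc_widen m n b) addnC.
exists (m + n)%N, (fun i => s * (if (i < n)%N then a i else 0) +
  t * (if (i < m)%N then b i else 0)).
rewrite /lc !scaler_sumr -big_split /=; apply: eq_bigr => i _.
by rewrite scalerDl !scalerA.
Qed.

Let span_u n : span (u n).
Proof.
exists n.+1, (fun i => (i == n)%:R); rewrite /lc big_ord_recr /= eqxx scale1r big1 ?add0r// => i _.
by rewrite ltn_eqF// scale0r.
Qed.

Let span_approx (z : V) : (forall h : dual V, (forall n, h (u n) = 0) -> h z = 0) ->
  forall e : R, 0 < e -> exists2 v, span v & `|z - v| < e.
Proof.
move=> hz e e0; apply: contrapT => nE.
have span0 : span 0 by exists 0%N, (fun=> 0); rewrite /lc big_ord0.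
have cS : convex_set span.
  by move=> v w t /[!inE] Sv Sw; exact: span_add.
have [|v Sv|g [d [d0 gd]]] := @convex_separation _ _ span z e cS _ e0.
- by exists 0.
- by rewrite leNgt; apply/negP => zv; apply: nE; exists v.
(* A functional bounded above on a subspace vanishes on it: otherwise some multiple of [u n] would
   take the value [g z]. *)
have gu n : g (u n) = 0.
  apply/eqP/negPn/negP => gn.
  have := gd ((g z / g (u n)) *: u n).
  have -> : (g z / g (u n)) *: u n = (g z / g (u n)) *: u n + 0 *: u n by rewrite scale0r addr0.
  move=> /(_ (span_add _ _ (span_u n) (span_u n))).
  rewrite scale0r addr0 dualZ divfK//.
  by rewrite gerDl leNgt d0.
by have := gd 0 span0; rewrite hz// dual0 add0r leNgt d0.
Qed.

Let qc (a : seq rat) := lc (size a) (fun i => ratr a`_i).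

Let rat_approx v (e : R) : span v -> 0 < e -> exists a, `|v - qc a| <= e.
Proof.
move=> [n [a ->]] e0.
have c0 : 0 <= c by exact: le_trans (normr_ge0 _) (uc 0).
(* Replacing [n] coefficients costs at most [n d c]; the [+ 1] keeps the denominator positive when
   [n] or [c] is 0. *)
pose d := e / (n%:R * c + 1).
have nc : 0 < n%:R * c + 1 by rewrite ltr_wpDl// mulr_ge0.
have d0 : 0 < d by rewrite divr_gt0.
have /choice[r rP] : forall i, exists r : rat, `|a i - ratr r| <= d.
  move=> i; have [|r] := @rat_in_itvoo R (a i) (a i + d); first by rewrite ltrDl.
  by rewrite in_itv /= => /andP[r1 r2]; exists r; rewrite ler_norml; lra.
exists (mkseq r n); rewrite /qc size_mkseq /lc -sumrB.
apply: (le_trans (ler_norm_sum _ _ _)).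
apply: (@le_trans _ _ (\sum_(i < n) d * c)).
  apply: ler_sum => i _; rewrite nth_mkseq// -scalerBl normrZ ler_pM//.
rewrite sumr_const card_ord -mulr_natl /d.
rewrite (_ : _ * _ = e * (n%:R * c) / (n%:R * c + 1)); last by ring.
by rewrite ler_pdivrMr// ler_pM2l// lerDl.
Qed.

(* The subsequence converges on the countable family of norming functionals of the rational
   combinations of [u]. These separate the points of the closed span of [u], so all ultrafilter
   limits of the subsequence coincide. *)
Lemma weak_seq_compact : reflexive_space V ->
  exists (s : nat -> nat) (x : V), increasing_seq s /\ weak_cvg (u \o s) x.
Proof.
move=> refl.
have /choice[gk gkP] : forall a : seq rat, exists g : dual V, `|g| <= 1 /\ g (qc a) = `|qc a|.
  by move=> a; have [g] := norming_functional (qc a); exists g.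
have sep z : (forall h : dual V, (forall n, h (u n) = 0) -> h z = 0) ->
    (forall a, gk a z = 0) -> z = 0.
  move=> hz gz; apply/eqP; rewrite -normr_le0; apply/ler_addgt0Pl => e e0; rewrite addr0.
  have e4 : 0 < e / 4 by rewrite divr_gt0.
  have [v Sv zv] := span_approx hz e4.
  have [a va] := rat_approx Sv e4.
  have [ga1 ga] := gkP a.
  have za : `|z - qc a| <= e / 2.
    rewrite (le_trans (ler_distD v _ _))//; move: zv va; lra.
  have qa : `|qc a| <= e / 2.
    rewrite -ga (_ : gk a (qc a) = - gk a (z - qc a)); last by rewrite dualB gz sub0r opprK.
    rewrite (le_trans (ler_norm _))// normrN (le_trans (dual_le _ _))//.
    by rewrite (le_trans _ za)// ler_piMl.
  rewrite -[z](subrK (qc a)) (le_trans (ler_normD _ _))//; move: za qa; lra.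
have [G [UG sG]] := ultraFilterLemma (@eventually_filter).
have [x xP] := @reflexive_ultra _ _ _ G UG u c refl (nearW _ uc).
(* The countable family indexed by [nat]; a number that codes no sequence gets the zero
   functional. *)
pose gk' k := if unpickle k is Some a then gk a else 0.
have step n N : exists m, (N < m)%N /\ forall k : 'I_n.+1, `|gk' k (u m) - gk' k x| <= n.+1%:R^-1.
  have : \forall m \near G, (N < m)%N /\ forall k : 'I_n.+1, `|gk' k (u m) - gk' k x| <= n.+1%:R^-1.
    apply: filterI; first by apply: sG; exact: nbhs_infty_gt.
    apply: filter_forall => k.
    have : 0 < n.+1%:R^-1 :> R by [].
    have /cvgrPdist_le H := xP (gk' k).
    by move=> /H; apply: filterS => m; rewrite distrC.
  by move=> /filter_ex.
have /choice[f fP] : forall p : nat * nat, exists m,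
    (p.2 < m)%N /\ forall k : 'I_p.1.+1, `|gk' k (u m) - gk' k x| <= p.1.+1%:R^-1.
  by move=> [n N]; exact: step.
pose s := fix s n := if n is n'.+1 then f (n, s n') else f (0, 0)%N.
have sP n : forall k : 'I_n.+1, `|gk' k (u (s n)) - gk' k x| <= n.+1%:R^-1.
  by case: n => [|n]; [exact: (fP (0, 0)%N).2|exact: (fP (n.+1, s n)).2].
have sinc : increasing_seq s.
  by apply/increasing_seqP => n; exact: (fP (n.+1, s n)).1.
exists s, x; split => // h; apply: ultra_cvg => G' UG' sG'.
have [y yP] := @reflexive_ultra _ _ _ G' UG' (u \o s) c refl (nearW _ (fun n => uc (s n))).
suff -> : x = y by exact: yP.
(* Functionals vanishing on the sequence vanish at both limits, so [x - y] lies in the closed span,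
   where the [gk a] separate points. *)
apply/eqP; rewrite -subr_eq0; apply/eqP/sep => [h' h'0|a].
  have lim0 (g : set_system nat) (PG : ProperFilter g) (w : V) (v : nat -> nat) :
    h' (u (v n)) @[n --> g] --> h' w -> h' w = 0.
    move=> H; apply: (cvg_unique (@norm_hausdorff _ R^o) H).
    by rewrite (_ : (fun n => _) = fun=> 0); [exact: cvg_cst|apply/funext => n; rewrite h'0].
  by rewrite dualB (lim0 G _ x id (xP h')) (lim0 G' _ y s (yP h')) subrr.
have gx : gk a (u (s n)) @[n --> G'] --> gk a x.
  apply: cvg_trans (cvg_app _ sG') _.
  apply: (cvg_dist_le (V := R^o) (g := fun n => n.+1%:R^-1)); last exact: cvg_harmonic.
  near=> n.
  have kn : (pickle a < n.+1)%N by rewrite ltnS; near: n; exact: nbhs_infty_ge.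
  have <- : gk' (pickle a) = gk a by rewrite /gk' pickleK.
  exact: (sP n (Ordinal kn)).
apply/eqP; rewrite dualB subr_eq0; apply/eqP.
exact: (cvg_unique (@norm_hausdorff _ R^o) gx (yP (gk a))).
Unshelve. all: by end_near. Qed.

End WeakCompactness.

(** * Variational inequalities *)

Section LimfEsup.
Context {R : realType} {T : topologicalType} (F : set_system T).

Lemma limf_esup_le (f : T -> R) (c : R) :
  (forall e, 0 < e -> \forall x \near F, f x <= c + e) ->
  (limf_esup (fun x => (f x)%:E) F <= c%:E)%E.
Proof.
move=> H; apply/lee_addgt0Pr => e e0.
have fe := H e e0.
apply: (@le_trans _ _ (ereal_sup ((fun x => (f x)%:E) @` [set x : T | f x <= c + e]))).
  by apply: ereal_inf_lbound; exists [set x : T | f x <= c + e].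
by apply: ge_ereal_sup => _ [x /= fx <-]; rewrite -EFinD lee_fin.
Qed.

Lemma limf_esup_ge (PF : ProperFilter F) (f : T -> R) (c : R) :
  (\forall x \near F, c <= f x) -> (c%:E <= limf_esup (fun x => (f x)%:E) F)%E.
Proof.
move=> cf; apply: le_ereal_inf_tmp => _ [A FA <-].
have [x [Ax cx]] := filter_ex (filterI FA cf).
by apply: (@le_trans _ _ (f x)%:E); [rewrite lee_fin|apply: ereal_sup_ubound; exists x].
Qed.

Lemma limf_esup_lt (PF : ProperFilter F) (f : T -> R) (c : R) :
  (limf_esup (fun x => (f x)%:E) F < c%:E)%E -> \forall x \near F, f x < c.
Proof.
move=> /ereal_inf_lt[_ [A FA <-]] Ac; apply: filterS FA => x Ax.
rewrite -lte_fin; apply: le_lt_trans Ac; apply: ereal_sup_ubound; by exists x.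
Qed.

End LimfEsup.

Lemma cvg_max0 {R : realType} {T : Type} {F : set_system T} {FF : ProperFilter F}
    (f : T -> R) (a : R) :
  f @ F --> a -> Num.max 0 (f x) @[x --> F] --> Num.max 0 a.
Proof.
move=> fa; apply: (cvg_dist_le (V := R^o) _ (cvg0_dist (V := R^o) fa)); apply: nearW => x.
rewrite ler_norml; have := ler_norm (f x - a); have := ler_norm (a - f x); rewrite distrC.
by case: (leP 0 (f x)); case: (leP 0 a); lra.
Qed.

Section Matrix.
Context {R : realType} {I : finType}.

(* Fixed points of [l |-> (l + (b l)^-) / (1 + sum (b l)^-)], as in Nash's existence proof. *)
Lemma skew_nonneg_solution (i0 : I) (b : I -> I -> R) : (forall i k, 0 <= b i k + b k i) ->
  exists2 l, simplex l & forall i, 0 <= \sum_k l k * b i k.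
Proof.
move=> bb.
pose a (l : I -> R) i := \sum_k l k * b i k.
pose c l i := Num.max 0 (- a l i).
pose F l i := (l i + c l i) / (1 + \sum_j c l j).
have c0 l i : 0 <= c l i by rewrite le_max lexx.
have d0 l : 0 < 1 + \sum_j c l j by rewrite ltr_wpDr// sumr_ge0.
have FS l : simplex l -> simplex (F l).
  move=> [l0 l1]; split=> [i|]; first by rewrite divr_ge0 ?(ltW (d0 l))// addr_ge0.
  by rewrite -mulr_suml big_split /= l1 divff// gt_eqF.
have S0 : simplex (fun i => (i == i0)%:R : R).
  by split=> [i|]; rewrite ?ler0n// (bigD1 i0)//= eqxx big1 ?addr0// => i /negbTE->.
have [|l lS Fl] := brouwer S0 FS.
  move=> G L l PG LS lS Ll.
  have ca i : c (L n) i @[n --> G] --> c l i.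
    apply: cvg_max0; apply: (@cvgN _ R^o); apply: (@cvg_sum_ord _ _ _ _ R^o) => k _.
    exact: cvgMr_tmp.
  move=> i; apply: cvgM; first by apply: cvgD => //.
  apply: cvgV; first by rewrite gt_eqF.
  by apply: cvgD; [exact: cvg_cst|apply: (@cvg_sum_ord _ _ _ _ R^o)].
exists l => //; have [l0 l1] := lS.
(* At the fixed point [c l i = l i * s]. If [s > 0], each index of positive weight has [a l i < 0],
   so the sum of [l i * a l i] is negative, whereas symmetrising it with [b i k + b k i >= 0] shows
   it is not. *)
pose s := \sum_j c l j.
have cs i : c l i = l i * s.
  have : F l i * (1 + s) = l i + c l i by rewrite /F divfK// gt_eqF.
  rewrite Fl; lra.
have s0 : s = 0.
  apply/eqP/negPn/negP => sn.
  have sp : 0 < s by rewrite lt_neqAle eq_sym sn sumr_ge0.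
  have neg i : 0 < l i -> a l i < 0.
    move=> li; have : 0 < c l i by rewrite cs mulr_gt0.
    by rewrite lt_max ltxx /= oppr_gt0.
  have : \sum_i l i * a l i < 0.
    have [i1 li1] : exists i, 0 < l i.
      apply: contrapT => nE; have := oner_neq0 R; rewrite -l1 big1 ?eqxx// => i _.
      by apply/le_anti; rewrite l0 andbT leNgt; apply/negP => li; apply: nE; exists i.
    have h1 : l i1 * a l i1 < 0 by rewrite pmulr_rlt0 ?neg.
    have h2 : \sum_(i | i != i1) l i * a l i <= 0.
      apply: sumr_le0 => i _; have := l0 i; rewrite le_eqVlt => /predU1P[<-|li].
        by rewrite mul0r.
      by rewrite ltW// pmulr_rlt0 ?neg.
    rewrite (bigD1 i1)//=; lra.
  have e : \sum_i l i * a l i = \sum_i \sum_k l i * l k * b i k.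
    by apply: eq_bigr => i _; rewrite mulr_sumr; apply: eq_bigr => k _; rewrite mulrA.
  have : 0 <= \sum_i l i * a l i + \sum_i l i * a l i.
    rewrite {1}e {1}exchange_big /= e -big_split /=; apply: sumr_ge0 => i _.
    rewrite -big_split /=; apply: sumr_ge0 => k _.
    by rewrite (mulrC (l k)) -mulrDr mulr_ge0 ?mulr_ge0.
  lra.
move=> i; have : c l i = 0 by rewrite cs s0 mulr0.
by rewrite -/(a l i) /c => /eqP; rewrite eq_le ge_max oppr_le0 lexx => /andP[].
Qed.

End Matrix.

Section Jensen.
Context {R : realType} {V : normedModType R} {I : finType}.
Variables (l : I -> R) (z : I -> V).
Hypothesis lS : simplex l.

Lemma jensen (phi : V -> R) (c : R) : convexf phi ->
  (forall x y, phi x - phi y <= c * `|x - y|) ->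
  phi (\sum_i l i *: z i) <= \sum_i l i * phi (z i).
Proof.
move=> cphi lphi; have [l0 l1] := lS; set u := \sum_i _.
have [g gP] := convex_subgradient u cphi lphi.
have : \sum_i l i * g (z i - u) <= \sum_i l i * (phi (z i) - phi u).
  by apply: ler_sum => i _; rewrite ler_wpM2l.
under [leRHS]eq_bigr do rewrite mulrBr.
rewrite sumrB -mulr_suml l1 mul1r.
suff -> : \sum_i l i * g (z i - u) = 0 by rewrite subr_ge0.
transitivity (g (\sum_i l i *: (z i - u))).
  by rewrite dual_sum; apply: eq_bigr => i _; rewrite dualZ.
under eq_bigr do rewrite scalerBr.
by rewrite sumrB -scaler_suml l1 scale1r subrr dual0.
Qed.

(** The triangle inequality, then nonnegativity of the variance of the distances [a i]. *)
Lemma sqr_norm_sum (x : V) :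
  `|x - \sum_i l i *: z i| ^+ 2 <= \sum_i l i * `|x - z i| ^+ 2.
Proof.
have [l0 l1] := lS; pose a i := `|x - z i|; pose m := \sum_i l i * a i.
have le1 : `|x - \sum_i l i *: z i| <= m.
  have -> : x - \sum_i l i *: z i = \sum_i l i *: (x - z i).
    by under [RHS]eq_bigr do rewrite scalerBr; rewrite sumrB -scaler_suml l1 scale1r.
  apply: (le_trans (ler_norm_sum _ _ _)); apply: ler_sum => i _.
  by rewrite normrZ ger0_norm.
have : 0 <= \sum_i l i * (a i - m) ^+ 2 by apply: sumr_ge0 => i _; rewrite mulr_ge0 ?sqr_ge0.
have -> : \sum_i l i * (a i - m) ^+ 2 = \sum_i l i * a i ^+ 2 - m ^+ 2.
  rewrite (eq_bigr (fun i => l i * a i ^+ 2 - (2 * m * (l i * a i) - m ^+ 2 * l i))); last first.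
    by move=> i _; ring.
  by rewrite sumrB sumrB -!mulr_sumr l1 -/m; ring.
rewrite subr_ge0; apply: le_trans; rewrite ler_pXn2r// nnegrE//.
exact: le_trans le1.
Qed.

End Jensen.

Section Pseudomonotone.
Context {R : realType} {V : normedModType R} (A : V -> dual V).
Hypothesis pA : pseudomonotone A.

Lemma pseudomonotone_bounded (r : R) : exists K : R, forall v, `|v| <= r -> `|A v| <= K.
Proof.
have [bA _] := pA.
have /bA : bounded_set [set v : V | `|v| <= r].
  exists r; split; first exact: num_real.
  by move=> x rx v /= vr; rewrite (le_trans vr)// ltW.
case=> K [_ KP]; exists (K + 1) => v vr; apply: (KP (K + 1)); first by rewrite ltrDl.
by exists v.
Qed.

(** [A] is bounded on bounded sets, so strong convergence makes [A (un n) (un n - u)] tend to 0 and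
    the limsup condition holds. This takes the place of hemicontinuity in Minty's trick and also
    concludes [solves_stable]. *)
Lemma pseudomonotone_strong (un : nat -> V) (u v : V) (cn : nat -> R) (c : R) :
  un @ \oo --> u -> (\forall n \near \oo, A (un n) (un n - v) <= cn n) -> cn @ \oo --> c ->
  A u (u - v) <= c.
Proof.
move=> unu Acn cnc.
have [K KP] := pseudomonotone_bounded (`|u| + 1).
have unb : \forall n \near \oo, `|un n| <= `|u| + 1.
  by apply: (cvgr_norm_le _ unu); rewrite ltrDl.
have wu : weak_cvg un u by move=> g; exact: dual_cvg.
have ls : (limn_esup (fun n => (A (un n) (un n - u))%:E) <= 0)%E.
  apply: limf_esup_le => e e0.
  have A0 : A (un n) (un n - u) @[n --> \oo] --> (0 : R).
    apply: (cvg_dist_le (V := R^o) (g := fun n => K * `|un n - u|)).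
      apply: filterS unb => n nb; rewrite subr0 (le_trans (dual_le _ _))//.
      by rewrite ler_wpM2r// KP.
    by rewrite -[X in _ --> X](mulr0 K); apply: cvgMl_tmp; exact: cvg0_dist.
  by apply: (cvgr_le _ A0); rewrite add0r.
have H := pA.2 un u wu ls v; rewrite -lee_fin; apply: (le_trans H).
apply: (le_trans (limn_einf_sup _)); apply: limf_esup_le => e e0.
have : \forall n \near \oo, cn n <= c + e by apply: (cvgr_le _ cnc); rewrite ltrDl.
by apply: filterS2 Acn => n; apply: le_trans.
Qed.

End Pseudomonotone.

(** * Variational inequalities on a fixed convex set *)

Section VariationalInequality.
Context {R : realType} {V : normedModType R}.
Variables (A : V -> dual V) (m c : R) (phi : V -> R) (l : dual V).
Hypothesis refl : reflexive_space V.
Hypothesis pA : pseudomonotone A.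
Hypothesis m0 : 0 < m.
Hypothesis sA : forall v1 v2 : V, (A v1 - A v2) (v1 - v2) >= m * `|v1 - v2| ^+ 2.
Hypothesis cphi : convexf phi.
Hypothesis c0 : 0 <= c.
Hypothesis lphi : forall x y, phi x - phi y <= c * `|x - y|.
Variable C : set V.
Hypothesis clC : closed C.
Hypothesis cC : convex_set C.

Lemma dual_fun_subE (f g : dual V) x : (f - g) x = f x - g x. Proof. by []. Qed.

(** Strong monotonicity gives [b i k + b k i >= 0], half of [m] being charged to each term.
    Convexity of [phi] and of the squared norm turns the weighted sums of [skew_nonneg_solution]
    into values at the mean [u]. The quadratic term is kept because it bounds [u] independently of
    the points. *)
Lemma minty_finite (I : finType) (i0 : I) (z : I -> V) : (forall i, C (z i)) ->
  exists u, C u /\ forall i, m / 2 * `|z i - u| ^+ 2 <= (A (z i) - l) (z i - u) + phi (z i) - phi u.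
Proof.
move=> Cz.
pose b i k : R := (A (z i) - l) (z i - z k) + phi (z i) - phi (z k) - m / 2 * `|z i - z k| ^+ 2.
have bb i k : 0 <= b i k + b k i.
  have := sA (z i) (z k).
  rewrite /b !dual_fun_subE -(opprB (z i) (z k)) !dualN normrN; lra.
have [x xS xb] := skew_nonneg_solution i0 bb; have [x0 x1] := xS.
exists (\sum_i x i *: z i); split; first exact: closed_convex_sum.
move=> i; have := xb i; set u := \sum_i x i *: z i.
have ju : phi u <= \sum_i x i * phi (z i) by exact: (jensen z xS cphi lphi).
have nu := sqr_norm_sum z xS (z i); rewrite -/u in nu.
have -> : \sum_k x k * b i k = (A (z i) - l) (z i - u) + phi (z i) - \sum_k x k * phi (z k)
   - m / 2 * \sum_k x k * `|z i - z k| ^+ 2.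
  rewrite (_ : (A (z i) - l) (z i - u) = \sum_k x k * (A (z i) - l) (z i - z k)); last first.
    have -> : z i - u = \sum_k x k *: (z i - z k).
      by under [RHS]eq_bigr do rewrite scalerBr; rewrite sumrB -scaler_suml x1 scale1r.
    by rewrite dual_sum; apply: eq_bigr => k _; rewrite dualZ.
  have e1 : phi (z i) = \sum_k x k * phi (z i) by rewrite -mulr_suml x1 mul1r.
  rewrite [X in _ + X - _ - _]e1 mulr_sumr -big_split /= -!sumrB.
  by apply: eq_bigr => k _; rewrite /b; ring.
have : m / 2 * `|z i - u| ^+ 2 <= m / 2 * \sum_k x k * `|z i - z k| ^+ 2.
  by rewrite ler_pM2l// divr_gt0.
lra.
Qed.

Lemma minty_solution : C 0 ->
  exists u, C u /\ forall z, C z -> 0 <= (A z - l) (z - u) + phi z - phi u.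
Proof.
move=> C0.
pose ok (s : seq V) u := C u /\ forall z, z \in s ->
    m / 2 * `|z - u| ^+ 2 <= (A z - l) (z - u) + phi z - phi u.
have /choice[U UP] : forall s : seq V, exists u, (forall z, z \in s -> C z) -> ok s u.
  move=> s; have [sC|nsC] := pselect (forall z, z \in s -> C z); last by exists 0.
  have Cs (i : 'I_(size (0 :: s))) : C (nth 0 (0 :: s) i).
    by have := mem_nth 0 (ltn_ord i); rewrite inE => /predU1P[->|/sC].
  have [u [Cu uP]] := minty_finite ord0 Cs; exists u => _; split => // z zs.
  have zi : (index z (0%R :: s) < size (0%R :: s))%N by rewrite index_mem inE zs orbT.
  by have := uP (Ordinal zi); rewrite /= nth_index// inE zs orbT.
(* Finite lists in [C] directed by inclusion: along any finer ultrafilter, each [z] in [C]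
   eventually belongs to the list. *)
pose fin := filter_from [set s0 : seq V | forall z, z \in s0 -> C z]
  (fun s0 => [set s : seq V | {subset s0 <= s} /\ forall z, z \in s -> C z]).
have PF : ProperFilter fin.
  apply: filter_from_proper; last by move=> s sC; exists s; split.
  apply: filter_from_filter; first by exists [::].
  move=> s t sC tC; exists (s ++ t).
    by move=> z; rewrite mem_cat => /orP[/sC|/tC].
  move=> w [stw wC]; split; split => // z zs; apply: stw; rewrite mem_cat zs ?orbT//.
have [G [UG sG]] := ultraFilterLemma PF.
have near1 z : C z -> \forall s \near G, z \in s /\ ok s (U s).
  move=> Cz; apply: sG; exists [:: z]; first by move=> ?; rewrite inE => /eqP->.
  by move=> s [zs sC]; split; [apply: zs; rewrite inE|exact: UP].
(* Testing with [0] gives [m / 2 * |U s|^2 <= K * |U s|]. *)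
pose K := `|A 0 - l| + c.
have UK : \forall s \near G, `|U s| <= 2 * K / m.
  apply: filterS (near1 0 C0) => s [s0 [_ /(_ 0 s0)]]; rewrite sub0r normrN => H.
  have h1 := dual_le (A 0 - l) (- U s); rewrite normrN in h1.
  have h2 := ler_norm ((A 0 - l) (- U s)).
  have h3 := lphi 0 (U s); rewrite sub0r normrN in h3.
  have h4 : m / 2 * `|U s| ^+ 2 <= K * `|U s| by rewrite mulrDl; lra.
  rewrite ler_pdivlMr// mulrC; have [n0|np] := leP `|U s| 0; last first.
    by rewrite -(ler_pM2r np); move: h4; rewrite expr2; lra.
  have u0 : U s = 0 by apply/eqP; rewrite -normr_le0.
  by rewrite u0 normr0 mulr0 mulr_ge0// addr_ge0.
have [u uP] := reflexive_ultra UG refl UK.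
exists u; split.
  apply: (closed_convex_weak _ clC cC _ uP).
  by apply: filterS (near1 0 C0) => s [_ []].
(* The subgradient at [u] bounds [phi (U s)] below by a weakly continuous function, so [phi] passes
   to the weak limit. *)
move=> z Cz; have [g gP] := convex_subgradient u cphi lphi.
have lim : (A z - l) (z - U s) + phi z - phi u - g (U s - u) @[s --> G] -->
    (A z - l) (z - u) + phi z - phi u - g (u - u).
  have gl (h : dual V) (v : V) : h (v - U s) @[s --> G] --> h (v - u).
    rewrite dualB; under eq_fun do rewrite dualB.
    by apply: (@cvgB _ R^o); [exact: cvg_cst|exact: uP].
  apply: (@cvgB _ R^o); last first.
    rewrite dualB; under eq_fun do rewrite dualB.
    by apply: (@cvgB _ R^o); [exact: uP|exact: cvg_cst].
  apply: (@cvgB _ R^o); last exact: cvg_cst.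
  by apply: (@cvgD _ R^o); [exact: gl|exact: cvg_cst].
have : 0 <= (A z - l) (z - u) + phi z - phi u - g (u - u).
  apply: (cvgr_to_ge lim); apply: filterS (near1 z Cz) => s [zs [_ /(_ z zs) H]].
  have : 0 <= m / 2 * `|z - U s| ^+ 2 by rewrite mulr_ge0 ?sqr_ge0// divr_ge0// ltW.
  have := gP (U s); lra.
by rewrite subrr dual0 subr0.
Qed.

(** Minty's inequality is tested at [w n] on the segment from [u] to [z]; convexity of [phi] lets
    [t n] be divided out before [w n] tends to [u]. *)
Lemma minty_hemicontinuous u : C u ->
  (forall z, C z -> 0 <= (A z - l) (z - u) + phi z - phi u) ->
  forall z, C z -> 0 <= (A u - l) (z - u) + phi z - phi u.
Proof.
move=> Cu H z Cz.
pose t (n : nat) : R := n.+1%:R^-1.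
have t01 n : 0 < t n <= 1 by rewrite invr_gt0 ltr0n invf_le1// ler1n.
pose w n := t n *: z + (1 - t n) *: u.
have wu n : w n - u = t n *: (z - u).
  by rewrite /w scalerBl scale1r scalerBr [u - _]addrC addrA addrK.
have t0 : t @ \oo --> (0 : R) by exact: cvg_harmonic.
have cw : w @ \oo --> u.
  apply: (cvg_dist_le (g := fun n => t n * `|z - u|)).
    by apply: nearW => n; rewrite wu normrZ gtr0_norm//; case/andP: (t01 n).
  by rewrite -[X in _ --> X](mul0r `|z - u|); exact: cvgMr_tmp.
pose d : R := - l (z - u) + phi z - phi u.
have Aw n : A (w n) (w n - z) <= (1 - t n) * d.
  have /andP[tp t1] := t01 n.
  have wz : w n - z = - ((1 - t n) *: (z - u)).
    by rewrite scalerBl scale1r opprB -wu opprB addrA subrK.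
  have := H (w n) (convex_set_conv cC Cz Cu (ltW tp) t1).
  have := cphi z u (ltW tp) t1; rewrite -/(w n) wu wz dualN !dualZ.
  rewrite dual_fun_subE => h1 h2.
  have h3 : 0 <= t n * (A (w n) (z - u) + d) by rewrite /d; lra.
  rewrite pmulr_rge0// in h3.
  rewrite -mulrN; apply: ler_wpM2l; [rewrite subr_ge0//|lra].
have cd : (1 - t n) * d @[n --> \oo] --> d.
  have : (1 - t n) * d @[n --> \oo] --> (1 - 0) * d.
    by apply: cvgMr_tmp; apply: (@cvgB _ R^o); [exact: cvg_cst|exact: t0].
  by rewrite subr0 mul1r.
have Awn : \forall n \near \oo, A (w n) (w n - z) <= (1 - t n) * d by exact: nearW.
have := pseudomonotone_strong pA cw Awn cd.
rewrite dual_fun_subE -(opprB z u) dualN /d; lra.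
Qed.

Lemma variational_inequality : C 0 ->
  exists u, C u /\ forall z, C z -> 0 <= (A u - l) (z - u) + phi z - phi u.
Proof.
move=> C0; have [u [Cu uP]] := minty_solution C0.
by exists u; split => //; exact: minty_hemicontinuous.
Qed.

Lemma variational_inequality_unique u v : C u -> C v ->
  (forall z, C z -> 0 <= (A u - l) (z - u) + phi z - phi u) ->
  (forall z, C z -> 0 <= (A v - l) (z - v) + phi z - phi v) -> u = v.
Proof.
move=> Cu Cv /(_ v Cv) hu /(_ u Cu) hv; apply/eqP; rewrite -subr_eq0 -normr_le0.
have := sA u v; move: hu hv; rewrite !dual_fun_subE -(opprB u v) !dualN => hu hv h.
have : m * `|u - v| ^+ 2 <= 0 by lra.
by rewrite pmulr_rle0// expr2 => h'; rewrite leNgt; apply/negP => up; have := mulr_gt0 up up;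
  rewrite ltNge h'.
Qed.

End VariationalInequality.

(** * Clarke subgradients *)

Section InnerProduct.
Context {R : realType} {X : normedModType R} (ip : {dot X for idfun}).
Hypothesis ip_norm : forall x : X, ip x x = `|x| ^+ 2.

Lemma ipDl x y z : ip (x + y) z = ip x z + ip y z. Proof. exact: linearDl. Qed.

Lemma ipDr x y z : ip z (x + y) = ip z x + ip z y. Proof. exact: linearDr. Qed.

Lemma ipZl t x z : ip (t *: x) z = t * ip x z. Proof. exact: linearZl_LR. Qed.

Lemma ipZr t x z : ip z (t *: x) = t * ip z x. Proof. exact: linearZr_LR. Qed.

Lemma ipNl x z : ip (- x) z = - ip x z. Proof. exact: linearNl. Qed.

Lemma ipC x z : ip z x = ip x z. Proof. by rewrite hermC expr0 mul1r. Qed.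

Lemma ip_normD x y : `|x + y| ^+ 2 = `|x| ^+ 2 + 2 * ip x y + `|y| ^+ 2.
Proof. by rewrite -!ip_norm ipDl !ipDr (ipC x y); ring. Qed.

(** Cauchy-Schwarz, from expanding the squared norm of [|y| x - |x| y]. *)
Lemma ip_le x y : `|ip x y| <= `|x| * `|y|.
Proof.
wlog xy : x / 0 <= ip x y => [H|].
  have [/H//|/ltW] := leP 0 (ip x y).
  by rewrite -oppr_ge0 -ipNl => /H; rewrite ipNl !normrN.
rewrite ger0_norm//.
have [->|x0] := eqVneq x 0.
  by rewrite -(scale0r 0) ipZl mul0r mulr_ge0.
have [->|y0] := eqVneq y 0.
  by rewrite -(scale0r 0) ipZr mul0r mulr_ge0.
have px : 0 < `|x| by rewrite normr_gt0.
have py : 0 < `|y| by rewrite normr_gt0.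
have := sqr_ge0 `|(`|y| *: x) + (- `|x|) *: y|.
rewrite ip_normD !normrZ ipZl ipZr normrN !normr_id.
have -> : (`|y| * `|x|) ^+ 2 + 2 * (`|y| * (- `|x| * ip x y)) + (`|x| * `|y|) ^+ 2 =
  (2 * (`|x| * `|y|)) * (`|x| * `|y| - ip x y) by ring.
by rewrite pmulr_rge0 ?mulr_gt0// subr_ge0.
Qed.

End InnerProduct.

Section SublinearSupport.
Context {R : realType} {X : completeNormedModType R} (ip : {dot X for idfun}).
Hypothesis ip_norm : forall x : X, ip x x = `|x| ^+ 2.

(* The support vector is [- x] for the minimiser [x] of [|x|^2 / 2 + p x]; this
   replaces Hahn-Banach followed by Riesz representation. *)
Lemma sublinear_support (p : X -> R) (L : R) : sublinear p -> 0 <= L ->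
  (forall v, p v <= L * `|v|) -> exists zeta, forall v, ip zeta v <= p v.
Proof.
move=> sp L0 pL.
pose E x := `|x| ^+ 2 / 2 + p x.
have pLN x : - (L * `|x|) <= p x.
  by rewrite (le_trans _ (sublinearN x sp))// lerN2 (le_trans (pL _))// normrN.
have Elb x : - (L ^+ 2) <= E x.
  have := pLN x; have := sqr_ge0 (`|x| / 2 - L); have := sqr_ge0 `|x|; rewrite /E.
  set n := `|x|; rewrite !expr2; lra.
pose e := inf (E @` setT).
have eE x : e <= E x by exact: (@inf_image_le _ _ setT E (- (L ^+ 2))).
have ex (d : R) : 0 < d -> exists x, E x < e + d.
  move=> d0; have hi : has_inf (E @` setT).
    by split; [exists (E 0), 0|exists (- (L ^+ 2)) => _ [x _ <-]].
  by have [_ [x _ <-]] := inf_adherent d0 hi; exists x.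
(* Parallelogram law at the midpoint: near-minimisers of [E] are close together, so the minimising
   sequence is Cauchy. *)
have close x y : `|x - y| ^+ 2 <= 4 * (E x - e) + 4 * (E y - e).
  have := eE (2^-1 *: (x + y)).
  have : p (2^-1 *: (x + y)) <= 2^-1 * (p x + p y).
    by rewrite sp.2 ?invr_ge0// ler_pM2l ?invr_gt0// sp.1.
  have h1 := ip_normD ip_norm x y; have := ip_normD ip_norm x (- y).
  rewrite normrN -scaleN1r ipZr scaleN1r => h2.
  rewrite /E normrZ exprMn h1 h2 ger0_norm ?invr_ge0//; move: (ip x y) => a; lra.
have [xn xnP] := choice (fun n : nat => ex n.+1%:R^-1 (harmonic_gt0 n)).
have h0 : n.+1%:R^-1 @[n --> \oo] --> (0 : R) by exact: cvg_harmonic.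
have [x xnx] : exists x : X, xn @ \oo --> x.
  suff /cauchy_cvgP : cauchy (xn @ \oo) by move=> /cvg_ex.
  apply/cauchy_exP => d d0.
  have : \forall n \near \oo, n.+1%:R^-1 < d ^+ 2 / 8 :> R.
    by apply: (cvgr_lt _ h0); rewrite divr_gt0// exprn_gt0.
  move=> [N _ NP]; exists (xn N); exists N => // n /= Nn.
  rewrite -ball_normE /= -(ltr_pXn2r (ltn0Sn 1)) ?nnegrE ?(ltW d0)//.
  apply: (le_lt_trans (close _ _)).
  have h1 : n.+1%:R^-1 < d ^+ 2 / 8 := NP n Nn.
  have h2 : N.+1%:R^-1 < d ^+ 2 / 8 := NP N (leqnn N).
  have := xnP n; have := xnP N; move: h1 h2.
  by move: (E (xn N)) (E (xn n)) (n.+1%:R^-1 : R) (N.+1%:R^-1 : R) (d ^+ 2) => *; lra.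
have p_cvg : p (xn n) @[n --> \oo] --> p x.
  apply: (cvg_dist_le (V := R^o) (g := fun n => L * `|xn n - x|)).
    apply: nearW => n; rewrite ler_norml.
    have := sp.1 (xn n - x) x; have := sp.1 (x - xn n) (xn n); rewrite !subrK.
    by have := pL (xn n - x); have := pL (x - xn n); rewrite (distrC x); lra.
  by rewrite -[X in _ --> X](mulr0 L); apply: cvgMl_tmp; exact: cvg0_dist.
have Ex : E x <= e.
  have Ecvg : E (xn n) @[n --> \oo] --> E x.
    apply: (@cvgD _ R^o) => //; apply: cvgMr_tmp.
    by apply: (cvgM (f := fun n => `|xn n|) (g := fun n => `|xn n|)); exact: cvg_norm.
  rewrite -[leRHS]addr0; apply: (cvg_ler Ecvg (@cvgD _ R^o _ _ _ _ _ _ _ (cvg_cst e) h0)).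
  by apply: nearW => n; exact: ltW.
exists (- x) => v; rewrite ipNl.
suff : 0 <= ip x v + p v by lra.
apply/ler_addgt0Pl => d d0; rewrite addrC.
(* Length of the variation [x + t v], small enough that [t |v|^2 <= d]. *)
pose t := d / (`|v| ^+ 2 + 1).
have v1 : 0 < `|v| ^+ 2 + 1 by rewrite ltr_wpDl// sqr_ge0.
have t0 : 0 < t by rewrite divr_gt0.
have := eE (x + t *: v); have := sp.1 x (t *: v); rewrite (sp.2 _ _ (ltW t0)).
move=> h1 h2; have : 0 <= t * (ip x v + t * `|v| ^+ 2 / 2 + p v).
  move: h2 Ex; rewrite /E (ip_normD ip_norm) ipZr normrZ (gtr0_norm t0) exprMn; lra.
rewrite pmulr_rge0// => h3.
have : t * `|v| ^+ 2 <= d.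
  rewrite /t mulrAC ler_pdivrMr// mulrDr mulr1 lerDl; exact: ltW.
have : 0 <= t * `|v| ^+ 2 by rewrite mulr_ge0 ?(ltW t0)// sqr_ge0.
lra.
Qed.

End SublinearSupport.

Section Clarke.
Context {R : realType} {X : normedModType R}.

Variables (h : X -> R) (x : X).
Hypothesis hlip : locally_lipschitz h.

Let F := filter_prod (nbhs x) (0 : R)^'+.

(** The Lipschitz estimate bounds the difference quotients, so the derivative is finite. Homogeneity
    and subadditivity come from the changes of variable [(y, s)] to [(y, t s)] and to
    [(y + s w, s)], which converge to the same filter. *)
Lemma clarke_sublinear : exists (p : X -> R) (L : R),
  [/\ forall v, clarke_derivative h x v = (p v)%:E, sublinear p, 0 <= L &
    forall v, p v <= L * `|v|].
Proof.
have PF : ProperFilter F by exact: filter_prod_proper.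
have F1 : fst @ F --> x by exact: cvg_fst.
have F2 : snd @ F --> (0 : R)^'+ by exact: cvg_snd.
have F20 : snd @ F --> (0 : R) by apply: (cvg_trans F2); exact: cvg_within.
have Fpos : F [set p | 0 < p.2].
  by apply: (F2 [set t | 0 < t]); exact: nbhs_right_gt.
have Fmove v : p.1 + p.2 *: v @[p --> F] --> x.
  rewrite -[X in _ --> X]addr0 -(scale0r v); apply: cvgD => //.
  exact: cvgZr_tmp.
have [N Nx [L [_ LP]]] := hlip x.
(* The Lipschitz estimate is available only for constants strictly above [L], hence the [+ 1]; the
   maximum makes [L1] nonnegative. *)
pose L1 := Num.max L 0 + 1.
have L1P y z : N y -> N z -> `|h y - h z| <= L1 * `|y - z|.
  move=> Ny Nz; apply: (LP L1 _ (y, z)); last by split.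
  by rewrite /L1 ltr_pwDr// le_max lexx.
have L10 : 0 <= L1 by rewrite addr_ge0// le_max lexx orbT.
pose Q v (p : X * R) := (h (p.1 + p.2 *: v) - h p.1) / p.2.
have Qb v : \forall p \near F, `|Q v p| <= L1 * `|v|.
  near=> p; have p0 : 0 < p.2 by near: p.
  rewrite normrM normfV (gtr0_norm p0) ler_pdivrMr//.
  apply: (le_trans (L1P _ _ _ _)).
  - by near: p; exact: (Fmove v).
  - by near: p; exact: F1.
  - by rewrite addrAC subrr add0r normrZ (gtr0_norm p0) mulrCA mulrC.
pose c v := clarke_derivative h x v.
have cE v : c v = limf_esup (fun p => (Q v p)%:E) F by [].
have cle v (b : R) : (forall e, 0 < e -> \forall p \near F, Q v p <= b + e) -> (c v <= b%:E)%E.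
  exact: limf_esup_le.
have cfin v : c v \is a fin_num.
  rewrite fin_numElt; apply/andP; split.
    apply: (@lt_le_trans _ _ (- (L1 * `|v|))%:E); first exact: ltNyr.
    by apply: limf_esup_ge; apply: filterS (Qb v) => p; rewrite ler_norml => /andP[].
  apply: (@le_lt_trans _ _ (L1 * `|v|)%:E); last exact: ltry.
  apply: cle => e e0; apply: filterS (Qb v) => p; rewrite ler_norml => /andP[_ /le_trans]; apply.
  by rewrite lerDl ltW.
pose p v := fine (c v).
have cp v : c v = (p v)%:E by rewrite fineK.
have pn v e : 0 < e -> \forall q \near F, Q v q < p v + e.
  by move=> e0; apply: limf_esup_lt; rewrite -cE cp lte_fin ltrDl.
have pl v b : (forall e, 0 < e -> \forall q \near F, Q v q <= b + e) -> p v <= b.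
  by move=> H; rewrite -lee_fin -cp; exact: cle.
have Fw (f : X * R -> X * R) : fst \o f @ F --> x -> snd \o f @ F --> (0 : R)^'+ -> f @ F --> F.
  move=> f1 f2 A [[P P'] [/= Px P0] PA].
  have H1 : F [set q | P (f q).1] by exact: (f1 _ Px).
  have H2 : F [set q | P' (f q).2] by exact: (f2 _ P0).
  by apply: filterS2 H1 H2 => q q1 q2; apply: PA.
have scale_le t v : 0 < t -> p (t *: v) <= t * p v.
  move=> t0; apply: pl => e e0.
  have Fs : (fun q : X * R => (q.1, t * q.2)) @ F --> F.
    apply: Fw => //= A A0.
    have tq : t * q.2 @[q --> F] --> (0 : R).
      have := @cvgMl_tmp _ _ F _ (@snd X R) t 0 F20; by rewrite mulr0; apply.
    have tqA : F [set q | 0 < t * q.2 -> A (t * q.2)] by exact: (tq _ A0).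
    by apply: filterS2 Fpos tqA => q q0; apply; exact: mulr_gt0.
  have H : F [set q | Q v (q.1, t * q.2) < p v + e / t].
    exact: (Fs _ (pn v (e / t) (divr_gt0 e0 t0))).
  apply: filterS2 Fpos H => q q0; rewrite /Q /= => H.
  rewrite scalerA (mulrC q.2).
  have q2 : q.2 != 0 by rewrite gt_eqF.
  have -> : (h (q.1 + (t * q.2) *: v) - h q.1) / q.2 =
      t * ((h (q.1 + (t * q.2) *: v) - h q.1) / (t * q.2)).
    by rewrite invfM mulrCA [t * (t^-1 * _)]mulrA divff ?gt_eqF// mul1r.
  have -> : t * p v + e = t * (p v + e / t).
    by rewrite mulrDr mulrCA divff ?gt_eqF// mulr1.
  by rewrite ler_pM2l// ltW.
exists p, L1; split => //.
- split=> [v w|t v].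
    apply: pl => e e0.
    have e2 : 0 < e / 2 by rewrite divr_gt0.
    have Fs : (fun q : X * R => (q.1 + q.2 *: w, q.2)) @ F --> F by apply: Fw;
      [exact: (Fmove w)|exact: F2].
    have H : F [set q | Q v (q.1 + q.2 *: w, q.2) < p v + e / 2] by exact: (Fs _ (pn v (e / 2) e2)).
    apply: filterS2 (pn w (e / 2) e2) H => q; rewrite /Q /= => H1 H2.
    rewrite scalerDr (addrC (q.2 *: v)) addrA.
    rewrite -(subrK (h (q.1 + q.2 *: w)) (h (q.1 + q.2 *: w + q.2 *: v))) -addrA mulrDl; lra.
  rewrite le_eqVlt => /predU1P[<-|t0].
    have Q0 q : Q 0 q = 0 by rewrite /Q scaler0 addr0 subrr mul0r.
    rewrite scale0r mul0r; apply/le_anti/andP; split.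
      by apply: pl => e e0; apply: nearW => q; rewrite Q0 add0r ltW.
    rewrite -lee_fin -cp; apply: limf_esup_ge; apply: nearW => q.
    by have := Q0 q; rewrite /Q => ->.
  apply/le_anti; rewrite scale_le//=.
  have ti : 0 < t^-1 by rewrite invr_gt0.
  have := scale_le _ (t *: v) ti.
  by rewrite scalerA mulVf ?gt_eqF// scale1r -ler_pdivlMl// invrK.
- move=> v; apply: pl => e e0; apply: filterS (Qb v) => q;
  rewrite ler_norml => /andP[_ /le_trans]; apply.
  by rewrite lerDl ltW.
Unshelve. all: by end_near. Qed.

End Clarke.

(** * Schauder approximation *)

Lemma increasing_seq_cvg (s : nat -> nat) : increasing_seq s -> s @ \oo --> \oo.
Proof.
move=> /increasing_seqP sS; have sn n : (n <= s n)%N.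
  by elim: n => // n IH; exact: (leq_ltn_trans IH (sS n)).
by move=> A [N _ NA]; exists N => // n /= Nn; apply: NA; exact: leq_trans (sn n).
Qed.

Section PartitionOfUnity.
Context {R : realType} {I : finType}.
Implicit Types d : I -> R.

(** Weights of the Schauder projection on an [e]-net, [d i] being the distance to node [i]; they
    also select the subgradients in [approximate_solution]. *)
Definition bump_weight (e : R) d i : R :=
  Num.max 0 (e - d i) / \sum_k Num.max 0 (e - d k).

Lemma bump_sum_gt0 e d i0 : d i0 < e -> 0 < \sum_k Num.max 0 (e - d k).
Proof.
move=> di; rewrite (bigD1 i0)//= ltr_pwDl//; last by apply: sumr_ge0 => i _; rewrite le_max lexx.
by rewrite lt_max subr_gt0 di orbT.
Qed.

Lemma bump_weight_simplex e d i0 : d i0 < e -> simplex (bump_weight e d).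
Proof.
move=> /bump_sum_gt0 s0; split=> [i|].
  by rewrite divr_ge0 ?(ltW s0)// le_max lexx.
by rewrite -mulr_suml divff// gt_eqF.
Qed.

Lemma bump_weight_support e d i : e <= d i -> bump_weight e d i = 0.
Proof. by move=> ed; rewrite /bump_weight max_l ?mul0r// subr_le0. Qed.

Lemma bump_weight_cvg (T : Type) (F : set_system T) (PF : ProperFilter F)
    e d i0 (dn : T -> I -> R) :
  d i0 < e -> (forall i, dn t i @[t --> F] --> d i) ->
  forall i, bump_weight e (dn t) i @[t --> F] --> bump_weight e d i.
Proof.
move=> /bump_sum_gt0 s0 dnd i.
have mc k : Num.max 0 (e - dn t k) @[t --> F] --> Num.max 0 (e - d k).
  by apply: cvg_max0; apply: (@cvgB _ R^o); [exact: cvg_cst|].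
apply: cvgM => //; apply: cvgV; first by rewrite gt_eqF.
by apply: (@cvg_sum_ord _ _ _ _ R^o).
Qed.

Lemma simplex_sum_le (l : I -> R) (a : I -> R) (c : R) : simplex l ->
  (forall i, l i != 0 -> a i <= c) -> \sum_i l i * a i <= c.
Proof.
move=> [l0 l1] ac; rewrite -[leRHS]mul1r -l1 mulr_suml; apply: ler_sum => i _.
have [->|li] := eqVneq (l i) 0; first by rewrite !mul0r.
by rewrite ler_wpM2l// ac.
Qed.

Lemma simplex_norm_le (V : normedModType R) (l : I -> R) (z : I -> V) (c : R) : simplex l ->
  (forall i, l i != 0 -> `|z i| <= c) -> `|\sum_i l i *: z i| <= c.
Proof.
move=> lS zc; apply: (le_trans (ler_norm_sum _ _ _)).
have [l0 _] := lS; under eq_bigr do rewrite normrZ ger0_norm//.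
exact: simplex_sum_le.
Qed.

End PartitionOfUnity.

(** Without a finite net, greedy choice produces points whose images are pairwise at least [e]
    apart, so that no subsequence of images converges. *)
Lemma finite_net {R : realType} {S : eqType} {V : normedModType R}
    (B : set S) (T : S -> V) (e : R) :
  (forall x : nat -> S, (forall n, B (x n)) ->
    exists (s : nat -> nat) (y : V), increasing_seq s /\ T (x (s n)) @[n --> \oo] --> y) ->
  0 < e -> exists p : seq S, (forall q, q \in p -> B q) /\
    forall x, B x -> exists2 q, q \in p & `|T x - T q| < e.
Proof.
move=> cT e0; apply: contrapT => nE.
have /choice[N NP] : forall p : seq S, exists x, (forall q, q \in p -> B q) ->
    B x /\ forall q, q \in p -> e <= `|T x - T q|.
  move=> p; apply: contrapT => nx; apply: nE; exists p; split.
    move=> q qp; apply: contrapT => nq; apply: nx; exists q => H; case: nq; exact: H.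
  move=> x Bx; apply: contrapT => H; apply: nx; exists x => _; split => // q qp.
  by rewrite leNgt; apply/negP => lt; apply: H; exists q.
pose l := fix l n := if n is n'.+1 then N (l n') :: l n' else [::].
have lB n : forall q, q \in l n -> B q.
  elim: n => //= n IH q; rewrite inE => /predU1P[->|/IH//].
  exact: (NP _ IH).1.
have sub n m : (n < m)%N -> N (l n) \in l m.
  elim: m => // m IH; rewrite ltnS leq_eqVlt inE => /predU1P[->|/IH ->].
    by rewrite eqxx.
  by rewrite orbT.
have [s [y [sinc Ty]]] := cT (fun n => N (l n)) (fun n => (NP _ (lB n)).1).
have : \forall n \near \oo, `|y - T (N (l (s n)))| < e / 2.
  by have /cvgrPdist_lt H := Ty; apply: H; rewrite divr_gt0.
move=> [K _ KP]; have k1 : `|y - T (N (l (s K)))| < e / 2 := KP K (leqnn K).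
have k2 : `|y - T (N (l (s K.+1)))| < e / 2 := KP K.+1 (leqnSn K).
have sK : (s K < s K.+1)%N by move/increasing_seqP: sinc; apply.
have := (NP _ (lB (s K.+1))).2 _ (sub _ _ sK).
rewrite leNgt => /negP; apply.
rewrite (le_lt_trans (ler_distD y _ _))// (distrC _ y); move: k1 k2; lra.
Qed.

(** Brouwer's theorem acts on the weights [l]: the mean [x l] of the net images is sent to the
    weights of the Schauder projection of [T (x l)]. At a fixed [l] the point [x l] is this
    projection, hence within [e] of [T (x l)]. Continuity is asked only up to subsequences, the form
    in which [solves_stable] provides it. *)
Lemma schauder_approx {R : realType} {V : normedModType R} (B : set V) (T : V -> V) (e : R) :
  closed B -> convex_set B -> B !=set0 -> (forall x, B x -> B (T x)) ->
  (forall (x : nat -> V) y, (forall n, B (x n)) -> B y -> x @ \oo --> y ->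
    exists s, increasing_seq s /\ T (x (s n)) @[n --> \oo] --> T y) ->
  (forall x : nat -> V, (forall n, B (x n)) ->
    exists (s : nat -> nat) (y : V), increasing_seq s /\ T (x (s n)) @[n --> \oo] --> y) ->
  0 < e -> exists x, B x /\ `|x - T x| <= e.
Proof.
move=> clB cB [b0 Bb0] BT sT cT e0.
have [p [pB pnet]] := finite_net cT e0.
pose I := 'I_(size p); pose y (i : I) := T (nth b0 p i).
have By i : B (y i) by apply/BT/pB/mem_nth.
have net x : B x -> exists i : I, `|T x - y i| < e.
  move=> /pnet[q qp xq]; have qi : (index q p < size p)%N by rewrite index_mem.
  by exists (Ordinal qi); rewrite /y nth_index.
have [i0 _] := net _ Bb0.
(* The filters in [brouwer] call for continuity in epsilon-delta form; a sequence of counterexamples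
   would have no subsequence with images tending to [T x]. *)
have Tc x : B x -> forall d : R, 0 < d -> exists2 d' : R, 0 < d' &
    forall y, B y -> `|y - x| < d' -> `|T y - T x| <= d.
  move=> Bx d d0; apply: contrapT => nd.
  have /choice[z zP] : forall n : nat, exists z,
      [/\ B z, `|z - x| <= n.+1%:R^-1 & d < `|T z - T x|].
    move=> n; apply: contrapT => nz; apply: nd; exists n.+1%:R^-1 => // z Bz zx.
    by rewrite leNgt; apply/negP => lt; apply: nz; exists z; split => //; exact: ltW.
  have [|||s [sinc Tz]] := sT z x => //.
  - by move=> n; case: (zP n).
  - apply: (cvg_dist_le (g := fun n => n.+1%:R^-1)); last exact: cvg_harmonic.
    by apply: nearW => n; case: (zP n).
  - have : d <= 0.
      apply: (cvgr_to_ge (cvg0_dist Tz)); apply: nearW => n; apply: ltW.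
      by case: (zP (s n)).
    by rewrite leNgt d0.
pose x l := \sum_(i : I) l i *: y i.
have Bx l : simplex l -> B (x l) by move=> lS; exact: closed_convex_sum.
pose F l := bump_weight e (fun i : I => `|T (x l) - y i|).
have [|||l lS Fl] := @brouwer R I F (fun i => (i == i0)%:R).
- by split=> [i|]; rewrite ?ler0n// (bigD1 i0)//= eqxx big1 ?addr0// => i /negbTE->.
- by move=> l /Bx/net[i ie]; exact: (@bump_weight_simplex _ _ _ _ i).
- move=> G L l PG LS lS Ll.
  have xL : x (L n) @[n --> G] --> x l.
    by apply: cvg_sum_ord => i _; exact: cvgZr_tmp.
  have TL : T (x (L n)) @[n --> G] --> T (x l).
    apply/cvgrPdist_le => d d0; have [d' d'0 dP] := Tc _ (Bx _ lS) d d0.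
    have /cvgrPdist_lt/(_ d' d'0) := xL; apply: filterS => n; rewrite distrC => h.
    by rewrite distrC; apply: dP => //; exact: Bx.
  have [i ie] := net _ (Bx _ lS).
  apply: (bump_weight_cvg _ ie) => k; apply: cvg_norm.
  by apply: cvgB => //; exact: cvg_cst.
exists (x l); split; first exact: Bx.
have [l0 l1] := lS.
have -> : x l - T (x l) = \sum_i l i *: (y i - T (x l)).
  by under [RHS]eq_bigr do rewrite scalerBr; rewrite sumrB -scaler_suml l1 scale1r.
apply: simplex_norm_le => // i; rewrite -{1}Fl => Fi.
rewrite distrC leNgt; apply/negP => lt; move/eqP: Fi; apply.
by apply: bump_weight_support; exact: ltW.
Qed.

(** * The quasivariational problem *)

Section CompactMap.
Context {R : realType} {V X : normedModType R} (ip : {dot X for idfun}).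
Hypothesis ip_norm : forall x : X, ip x x = `|x| ^+ 2.
Variable M : {linear V -> X}.
Hypothesis M_bounded : exists c : R, forall v : V, `|M v| <= c * `|v|.

Lemma opnorm_has_ubound : has_ubound [set `|M x| | x in [set x : V | `|x| <= 1]].
Proof.
have [c Mc] := M_bounded; exists (Num.max c 0) => _ [x /= x1 <-].
have cm : c <= Num.max c 0 by rewrite le_max lexx.
apply: (le_trans (Mc x)); apply: (le_trans (ler_wpM2r (normr_ge0 x) cm)).
by rewrite ler_piMr// le_max lexx orbT.
Qed.

Lemma le_opnorm v : `|M v| <= opnorm M * `|v|.
Proof.
have [->|v0] := eqVneq v 0; first by rewrite linear0 !normr0 mulr0.
have nv : 0 < `|v| by rewrite normr_gt0.
rewrite -ler_pdivrMr//; apply: ub_le_sup; first exact: opnorm_has_ubound.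
exists (`|v|^-1 *: v); first by rewrite /= normrZ normfV normr_id mulVf ?normr_eq0.
by rewrite linearZ /= normrZ normfV normr_id mulrC.
Qed.

Lemma opnorm_ge0 : 0 <= opnorm M.
Proof.
apply: ub_le_sup; first exact: opnorm_has_ubound.
by exists 0; rewrite /= ?linear0 normr0.
Qed.

Lemma bounded_linear_cvg (T : Type) (F : set_system T) (FF : ProperFilter F) (h : T -> V) v :
  h @ F --> v -> M (h t) @[t --> F] --> M v.
Proof.
move=> hv; apply: (cvg_dist_le (g := fun t => opnorm M * `|h t - v|)).
  by apply: nearW => t; rewrite -linearB le_opnorm.
by rewrite -[X in _ --> X](mulr0 (opnorm M)); apply: cvgMl_tmp; exact: cvg0_dist.
Qed.

Lemma ip_comp_dual (a : X) : exists g : dual V, forall v, g v = ip a (M v).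
Proof.
apply: (@mk_dual _ _ _ (`|a| * opnorm M)) => [t x y|v].
  by rewrite linearP ipDr ipZr.
by rewrite (le_trans (ip_le ip_norm _ _))// -mulrA ler_wpM2l// le_opnorm.
Qed.

(** Compactness gives a strong limit [l] along each ultrafilter, and pairing with [M x - l] shows
    that [l] is [M x]. *)
Lemma compact_map_weak_cvg (u : nat -> V) (x : V) (r : R) : compact_map M ->
  (forall n, `|u n| <= r) -> weak_cvg u x -> M (u n) @[n --> \oo] --> M x.
Proof.
move=> cM ur wu; apply: ultra_cvg => G UG sG.
have : precompact (M @` [set v : V | `|v| <= r]).
  apply: cM; exists r; split; first exact: num_real.
  by move=> y ry v /= vr; rewrite (le_trans vr)// ltW.
rewrite precompactE => cK.
have [l Ml] : exists l : X, M (u n) @[n --> G] --> l.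
  apply: (ultra_compact_cvg UG cK); apply: nearW => n; apply: subset_closure.
  by exists (u n) => //=; exact: ur.
suff -> : M x = l by [].
apply/eqP; rewrite -subr_eq0 -normr_eq0 -sqrf_eq0 -ip_norm.
set a := M x - l; rewrite {2}/a ipDr -scaleN1r ipZr mulN1r subr_eq0; apply/eqP.
have [g gE] := ip_comp_dual a.
have c1 : ip a (M (u n)) @[n --> G] --> ip a (M x).
  rewrite -gE; under eq_fun do rewrite -gE.
  exact: cvg_trans (cvg_app _ sG) (wu g).
have c2 : ip a (M (u n)) @[n --> G] --> ip a l.
  apply: (cvg_dist_le (V := R^o) (g := fun n => `|a| * `|M (u n) - l|)).
    apply: nearW => n; have -> : ip a (M (u n)) - ip a l = ip a (M (u n) - l).
      by rewrite ipDr -[in RHS]scaleN1r ipZr mulN1r.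
    exact: ip_le.
  by rewrite -[X in _ --> X](mulr0 `|a|); apply: cvgMl_tmp; exact: cvg0_dist.
exact: (cvg_unique (@norm_hausdorff _ R^o) c1 c2).
Qed.

End CompactMap.

(** * The auxiliary problem with frozen constraint set and gradient *)

Section Quasivariational.
Context {R : realType} {V : normedModType R} (V_refl : reflexive_space V).
Context {X : completeNormedModType R} (ip : {dot X for idfun}).
Hypothesis ip_norm : forall x : X, ip x x = `|x| ^+ 2.
Variables (A : V -> dual V) (M : {linear V -> X}) (U : V -> set V) (phi : V -> R).
Variables (f : dual V) (m c : R).
Hypothesis A_pseudo : pseudomonotone A.
Hypothesis m_gt0 : 0 < m.
Hypothesis A_strong : forall v1 v2 : V, (A v1 - A v2) (v1 - v2) >= m * `|v1 - v2| ^+ 2.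
Hypothesis M_bounded : exists c : R, forall v : V, `|M v| <= c * `|v|.
Hypothesis M_compact : compact_map M.
Hypothesis U_closed : forall v : V, closed (U v).
Hypothesis U_convex : forall v : V, convex_set (U v).
Hypothesis U_0 : forall v : V, U v 0.
Hypothesis U_mosco : weakly_mosco_continuous U.
Hypothesis phi_convex : convexf phi.
Hypothesis c_ge0 : 0 <= c.
Hypothesis phi_lip : forall v1 v2 : V, phi v1 - phi v2 <= c * `|v1 - v2|.

Definition solves (v : V) (xi : X) (u : V) := U v u /\
  forall z, U v z -> 0 <= (A u - f) (z - u) + ip xi (M z - M u) + phi z - phi u.

(** The gradient term is absorbed into the data: [l] is [f] minus the adjoint of [M] applied to
    [xi]. *)
Lemma shifted_functional xi : exists l : dual V, forall (u z : V),
  (A u - l) (z - u) = (A u - f) (z - u) + ip xi (M z - M u).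
Proof.
have [g gE] := ip_comp_dual ip_norm M_bounded xi.
exists (f - g) => u z; rewrite !dual_fun_subE.
by rewrite (gE (z - u)) linearB; ring.
Qed.

Lemma solves_ex v xi : exists u, solves v xi u.
Proof.
have [l lE] := shifted_functional xi.
have [u [Cu uP]] := variational_inequality l V_refl A_pseudo m_gt0 A_strong phi_convex c_ge0
  phi_lip (@U_closed v) (@U_convex v) (U_0 v).
by exists u; split => // z /uP; rewrite lE.
Qed.

Lemma solves_unique v xi u w : solves v xi u -> solves v xi w -> u = w.
Proof.
have [l lE] := shifted_functional xi.
move=> [Uu uP] [Uw wP].
by apply: (variational_inequality_unique (l := l) m_gt0 A_strong Uu Uw) => z Uz; rewrite lE; auto.
Qed.

(** Testing with [0], which lies in [U v], and comparing [A u] with [A 0]. *)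
Lemma solves_bound v xi u : solves v xi u ->
  m * `|u| <= `|f| + `|A 0| + c + opnorm M * `|xi|.
Proof.
move=> [Uu /(_ 0 (U_0 v))]; rewrite sub0r linear0 sub0r => H.
have := A_strong u 0; rewrite subr0 dual_fun_subE => H1.
have [u0|up] := leP `|u| 0.
  have -> : `|u| = 0 by apply/le_anti; rewrite u0 normr_ge0.
  by rewrite mulr0 !addr_ge0// mulr_ge0// opnorm_ge0.
rewrite -(ler_pM2r up).
have h1 := dual_le f u; have h1' := ler_norm (f u).
have h2 := dual_le (A 0) u; have h2' := ler_norm (- A 0 u); rewrite normrN in h2'.
have h3 := phi_lip 0 u; rewrite sub0r normrN in h3.
have h4 := ip_le ip_norm xi (- M u); have h4' := ler_norm (ip xi (- M u)).
rewrite normrN in h4.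
have h5 : `|xi| * `|M u| <= opnorm M * `|xi| * `|u|.
  by rewrite mulrAC [leRHS]mulrC ler_wpM2l// le_opnorm.
move: H H1; rewrite dual_fun_subE !dualN -mulrA -expr2 !mulrDl; lra.
Qed.

Lemma lipschitz_cvg (T : Type) (F : set_system T) (PF : ProperFilter F) (h : T -> V) v :
  h @ F --> v -> phi (h t) @[t --> F] --> phi v.
Proof.
move=> hv; apply: (cvg_dist_le (V := R^o) (g := fun t => c * `|h t - v|)).
  apply: nearW => t; have := phi_lip (h t) v; have := phi_lip v (h t).
  by rewrite ler_norml (distrC v); lra.
by rewrite -[X in _ --> X](mulr0 c); apply: cvgMl_tmp; exact: cvg0_dist.
Qed.

(** The gradients [xin] need not converge; an eventual upper bound [b] on their pairing with
    [M z - M u] suffices. The same lemma therefore serves for the continuity of the solution map,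
    where [b] comes from convergent gradients, and for the final limit, where it comes from upper
    semicontinuity of [j^0]. *)
Lemma solves_stable (vn un : nat -> V) (xin : nat -> X) (v : V) (r L : R) :
  weak_cvg vn v -> (forall n, `|un n| <= r) -> (forall n, `|xin n| <= L) ->
  (forall n, solves (vn n) (xin n) (un n)) ->
  exists (s : nat -> nat) (u : V), [/\ increasing_seq s, un (s n) @[n --> \oo] --> u, U v u &
    forall z (b : R), U v z -> (\forall n \near \oo, ip (xin (s n)) (M z - M u) <= b) ->
    0 <= (A u - f) (z - u) + b + phi z - phi u].
Proof.
move=> vnv unr xinL sol.
have [s [u [sinc wu]]] := weak_seq_compact unr V_refl.
have [mosco1 mosco2] := U_mosco vnv.
have Uu : U v u by apply: (mosco1 un s) => // n; exact: (sol n).1.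
have sub (z : nat -> V) (y : V) : z @ \oo --> y -> z (s n) @[n --> \oo] --> y.
  by move=> zy; exact: (cvg_comp _ _ (increasing_seq_cvg sinc) zy).
have Mu : M (un (s n)) @[n --> \oo] --> M u.
  by apply: (compact_map_weak_cvg ip_norm M_bounded (u := un \o s) M_compact _ wu) => n; exact: unr.
have [K KP] := pseudomonotone_bounded A_pseudo r.
have AK n (z : V) : A (un (s n)) z <= K * `|z|.
  by rewrite (le_trans (ler_norm _))// (le_trans (dual_le _ _))// ler_wpM2r// KP.
have L0 : 0 <= L by exact: le_trans (normr_ge0 _) (xinL 0).
(* The test point must lie in the moving set, so a recovery sequence is tested; replacing [z (s n)]
   by its limit [y] under [A] costs [K |z (s n) - y|]. *)
have key (z : nat -> V) (y : V) n : U (vn (s n)) (z (s n)) ->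
    A (un (s n)) (un (s n) - y) <= f (un (s n) - z (s n)) +
      ip (xin (s n)) (M (z (s n)) - M (un (s n)))
      + phi (z (s n)) - phi (un (s n)) + K * `|z (s n) - y|.
  move=> Uz; have := (sol (s n)).2 _ Uz.
  have := AK n (z (s n) - y).
  rewrite dual_fun_subE -(opprB (un (s n)) (z (s n))) !dualN.
  have -> : A (un (s n)) (z (s n) - y) =
    A (un (s n)) (un (s n) - y) - A (un (s n)) (un (s n) - z (s n)).
    by rewrite -dualB; congr (A _ _); rewrite opprB [RHS]addrC addrA subrK.
  lra.
have Mdiff (z : nat -> V) (y : V) : z @ \oo --> y ->
    L * (`|M (z (s n)) - M y| + `|M (un (s n)) - M u|) @[n --> \oo] --> (0 : R).
  move=> zy; rewrite -[X in _ --> X](mulr0 L); apply: cvgMl_tmp.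
  rewrite -[X in _ --> X](addr0 0); apply: cvgD; apply: cvg0_dist => //.
  by apply: bounded_linear_cvg => //; exact: sub.
have ipd (z : nat -> V) (y : V) n : ip (xin (s n)) (M (z (s n)) - M (un (s n))) <=
    ip (xin (s n)) (M y - M u) + L * (`|M (z (s n)) - M y| + `|M (un (s n)) - M u|).
  have -> : M (z (s n)) - M (un (s n)) = (M y - M u) + ((M (z (s n)) - M y) - (M (un (s n)) - M u)).
    by rewrite opprB addrA [(M y - M u) + _]addrC [M _ - M y + _]addrA subrK addrA subrK.
  rewrite ipDr lerD2l (le_trans (ler_norm _))// (le_trans (ip_le ip_norm _ _))//.
  apply: ler_pM => //; exact: ler_normB.
have weakdiff (g : dual V) (z : nat -> V) (y : V) : z @ \oo --> y ->
    g (un (s n) - z (s n)) @[n --> \oo] --> g (u - y).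
  move=> zy; rewrite dualB; under eq_fun do rewrite dualB.
  by apply: (@cvgB _ R^o); [exact: wu|exact: dual_cvg (sub _ _ zy)].
have uu : un (s n) @[n --> \oo] --> u.
  have [w Uw wn] := mosco2 _ Uu.
  have [g gP] := convex_subgradient u phi_convex phi_lip.
  (* [E n] bounds [m |un (s n) - u|^2]: the inequality is tested with a recovery sequence of [u]
     itself, and [phi] is bounded below by its subgradient [g]. Every term tends to 0 by weak
     convergence, compactness of [M] or strong convergence of [w]. *)
  pose E n := f (un (s n) - w (s n)) + L * (`|M (w (s n)) - M u| + `|M (un (s n)) - M u|)
     + (phi (w (s n)) - phi u) + K * `|w (s n) - u| - g (un (s n) - u) - A u (un (s n) - u).
  have cu0 : (fun=> u) @ \oo --> u by exact: cvg_cst.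
  have E0 : E @ \oo --> (0 : R).
    rewrite (_ : 0 = f (u - u) + 0 + (phi u - phi u) + 0 - g (u - u) - A u (u - u)); last first.
      by rewrite !subrr !dual0; ring.
    apply: (@cvgB _ R^o); last exact: (weakdiff (A u) (fun=> u)).
    apply: (@cvgB _ R^o); last exact: (weakdiff g (fun=> u)).
    apply: (@cvgD _ R^o); last first.
      by rewrite -[X in _ --> X](mulr0 K); apply: cvgMl_tmp; apply: cvg0_dist; exact: sub.
    apply: (@cvgD _ R^o); last first.
      by apply: (@cvgB _ R^o); [apply: lipschitz_cvg; exact: sub|exact: cvg_cst].
    by apply: (@cvgD _ R^o); [exact: weakdiff|exact: Mdiff].
  have uE n : m * `|un (s n) - u| ^+ 2 <= E n.
    have := A_strong (un (s n)) u; rewrite dual_fun_subE.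
    have := key w u n (Uw _); have := ipd w u n; rewrite subrr -(scale0r 0) ipZr mul0r add0r.
    have := gP (un (s n)); rewrite /E; lra.
  apply/cvgrPdist_le => e e0.
  have e2 : 0 < m * e ^+ 2 by rewrite mulr_gt0// exprn_gt0.
  have : \forall n \near \oo, E n <= m * e ^+ 2 by apply: (cvgr_le _ E0).
  apply: filterS => n En; have := le_trans (uE n) En.
  by rewrite ler_pM2l// ler_pXn2r ?nnegrE ?(ltW e0)// distrC.
exists s, u; split => // z b Uz hb.
have [y Uy yz] := mosco2 _ Uz.
have lim : f (un (s n) - y (s n)) + (b + L * (`|M (y (s n)) - M z| + `|M (un (s n)) - M u|))
      + phi (y (s n)) - phi (un (s n)) + K * `|y (s n) - z| @[n --> \oo] -->
    f (u - z) + (b + 0) + phi z - phi u + 0.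
  apply: (@cvgD _ R^o); last first.
    by rewrite -[X in _ --> X](mulr0 K); apply: cvgMl_tmp; apply: cvg0_dist; exact: sub.
  apply: (@cvgB _ R^o); last exact: lipschitz_cvg.
  apply: (@cvgD _ R^o); last by apply: lipschitz_cvg; exact: sub.
  apply: (@cvgD _ R^o); first exact: weakdiff.
  by apply: (@cvgD _ R^o); [exact: cvg_cst|exact: Mdiff].
have := pseudomonotone_strong A_pseudo (v := z) uu _ lim.
rewrite dual_fun_subE -(opprB z u) !dualN => H.
have {}H : - A u (z - u) <= - f (z - u) + (b + 0) + phi z - phi u + 0.
  apply: H; apply: filterS hb => n hb.
  have := key y z n (Uy _); have := ipd y z n; lra.
move: H; lra.
Qed.

End Quasivariational.

(** * Approximate fixed points of the auxiliary solution map *)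

Section Approximation.
Context {R : realType} {V : normedModType R} (V_refl : reflexive_space V).
Context {X : completeNormedModType R} (ip : {dot X for idfun}).
Hypothesis ip_norm : forall x : X, ip x x = `|x| ^+ 2.
Variables (A : V -> dual V) (M : {linear V -> X}) (U : V -> set V) (phi : V -> R).
Variables (f : dual V) (m c : R).
Hypothesis A_pseudo : pseudomonotone A.
Hypothesis m_gt0 : 0 < m.
Hypothesis A_strong : forall v1 v2 : V, (A v1 - A v2) (v1 - v2) >= m * `|v1 - v2| ^+ 2.
Hypothesis M_bounded : exists c : R, forall v : V, `|M v| <= c * `|v|.
Hypothesis M_compact : compact_map M.
Hypothesis U_closed : forall v : V, closed (U v).
Hypothesis U_convex : forall v : V, convex_set (U v).
Hypothesis U_0 : forall v : V, U v 0.
Hypothesis U_mosco : weakly_mosco_continuous U.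
Hypothesis phi_convex : convexf phi.
Hypothesis c_ge0 : 0 <= c.
Hypothesis phi_lip : forall v1 v2 : V, phi v1 - phi v2 <= c * `|v1 - v2|.
Variables (S : X -> set X) (r L : R).
Hypothesis r_ge0 : 0 <= r.
Hypothesis S_ex : forall w : V, exists zeta, S (M w) zeta.
Hypothesis S_bound : forall (w : V) zeta, `|w| <= r -> S (M w) zeta -> `|zeta| <= L.
Hypothesis r_bound : `|f| + `|A 0| + c + opnorm M * L <= m * r.

Let B : set V := [set v | `|v| <= r].

Let B_closed : closed B.
Proof.
apply: (@closed_comp _ _ (fun v : V => `|v|) [set x | x <= r]); last exact: closed_le.
by move=> v _; exact: norm_continuous.
Qed.

Let B_convex : convex_set B.
Proof.
move=> x y t /[!inE] xr yr; rewrite /B /= (le_trans (ler_normD _ _))// !normrZ.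
rewrite ger0_norm// ger0_norm ?subr_ge0//.
have -> : r = t%:num * r + (1 - t%:num) * r by ring.
by rewrite lerD// ler_wpM2l// subr_ge0.
Qed.

(** The last clause hides how [xi] is built: upper bounds linear in the gradient pass from the
    selected gradients to their average. One [e] serves both as the mesh of the net and as the
    tolerance of the fixed point. *)
Lemma approximate_solution (e : R) : 0 < e -> exists (x u : V) (xi : X),
  [/\ `|x| <= r /\ `|u| <= r, `|x - u| <= e, `|xi| <= L, solves ip A M U phi f x xi u &
    forall (y : X) (b : R), (forall (q : V) zeta, `|q| <= r -> `|M x - M q| < e ->
      S (M q) zeta -> ip zeta y <= b) ->
      ip xi y <= b].
Proof.
move=> e0.
have weakB (x : nat -> V) : (forall n, B (x n)) -> exists (s : nat -> nat) (y : V),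
    increasing_seq s /\ weak_cvg (x \o s) y.
  by move=> xB; exact: weak_seq_compact xB V_refl.
have [p [pB pnet]] : exists p : seq V, (forall q, q \in p -> B q) /\
    forall x, B x -> exists2 q, q \in p & `|M x - M q| < e.
  apply: finite_net => // x xB; have [s [y [sinc wy]]] := weakB x xB.
  exists s, (M y); split => //.
  by apply: (compact_map_weak_cvg ip_norm M_bounded (u := x \o s) M_compact _ wy) => n; exact: xB.
pose I := 'I_(size p); pose q (i : I) := nth 0 p i.
have qB i : B (q i) by apply/pB/mem_nth.
have [zeta zetaP] := choice (fun i => S_ex (q i)).
pose w v := bump_weight e (fun i : I => `|M v - M (q i)|).
pose xi v := \sum_i w v i *: zeta i.
have net v : B v -> exists i : I, `|M v - M (q i)| < e.
  move=> /pnet[y yp vy]; have yi : (index y p < size p)%N by rewrite index_mem.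
  by exists (Ordinal yi); rewrite /q nth_index.
have wS v : B v -> simplex (w v).
  by move=> /net[i ie]; exact: (bump_weight_simplex (i0 := i)).
have xiL v : B v -> `|xi v| <= L.
  move=> Bv; apply: (simplex_norm_le (wS v Bv)) => i _.
  exact: S_bound (qB i) (zetaP i).
have solex v := solves_ex V_refl ip_norm f A_pseudo m_gt0 A_strong M_bounded U_closed U_convex
  U_0 phi_convex c_ge0
  phi_lip v (xi v).
have /choice[T TP] := solex.
have BT v : B v -> B (T v).
  move=> Bv; rewrite /B /= -(ler_pM2l m_gt0).
  apply: (le_trans (solves_bound ip_norm A_strong M_bounded U_0 c_ge0 phi_lip (TP v))).
  apply: le_trans r_bound; rewrite lerD2l ler_wpM2l ?opnorm_ge0//.
  exact: xiL.
(* This supplies both hypotheses of [schauder_approx]: continuity, after uniqueness identifies the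
   limit with [T v], and relative compactness of the range. *)
have stable (x : nat -> V) v : (forall n, B (x n)) -> weak_cvg x v ->
    exists (s : nat -> nat) (u : V), [/\ increasing_seq s, T (x (s n)) @[n --> \oo] --> u, U v u &
    forall z (b : R), U v z -> (\forall n \near \oo, ip (xi (x (s n))) (M z - M u) <= b) ->
    0 <= (A u - f) (z - u) + b + phi z - phi u].
  move=> xB xv.
  apply: (solves_stable V_refl ip_norm A_pseudo m_gt0 A_strong M_bounded M_compact U_mosco
    phi_convex phi_lip xv (un := T \o x) (xin := xi \o x) (r := r) (L := L)) => n.
  - by apply: BT.
  - by apply: xiL.
  - exact: TP.
have [|||x [Bx xT]] := schauder_approx B_closed B_convex _ BT _ _ e0.
- by exists 0; rewrite /B /= normr0.
- move=> x v xB Bv xv.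
  have [|s [u [sinc Tu Uu uP]]] := stable x v xB; first by move=> g; exact: dual_cvg.
  exists s; split => //; suff -> : T v = u by [].
  apply: (solves_unique ip_norm m_gt0 A_strong M_bounded (TP v)); split => // z Uz.
  have [i ie] := net v Bv.
  have xs : x (s n) @[n --> \oo] --> v.
    exact: (cvg_comp _ _ (increasing_seq_cvg sinc) xv).
  have xic : xi (x (s n)) @[n --> \oo] --> xi v.
    apply: cvg_sum_ord => k _; apply: cvgZr_tmp.
    apply: (bump_weight_cvg _ ie) => j; apply: cvg_norm.
    by apply: cvgB; [exact: bounded_linear_cvg|exact: cvg_cst].
  have ipc : ip (xi (x (s n))) (M z - M u) @[n --> \oo] --> ip (xi v) (M z - M u).
    apply: (cvg_dist_le (V := R^o) (g := fun n => `|xi (x (s n)) - xi v| * `|M z - M u|)).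
      apply: nearW => n.
      have -> : ip (xi (x (s n))) (M z - M u) - ip (xi v) (M z - M u) =
        ip (xi (x (s n)) - xi v) (M z - M u).
        by rewrite ipDl ipNl.
      exact: ip_le.
    rewrite -[X in _ --> X](mul0r `|M z - M u|); apply: cvgMr_tmp; exact: cvg0_dist.
  apply/ler_addgt0Pl => d d0.
  have := uP z (ip (xi v) (M z - M u) + d) Uz; rewrite [leRHS]addrC.
  have H : \forall n \near \oo, ip (xi (x (s n))) (M z - M u) <= ip (xi v) (M z - M u) + d.
    by apply: (cvgr_le _ ipc); rewrite ltrDl.
  by move=> /(_ H); lra.
- move=> x xB; have [s [y [sinc wy]]] := weakB x xB.
  have [|s' [u [s'inc Tu _ _]]] := stable (x \o s) y _ wy; first by move=> n; exact: xB.
  exists (s \o s'), u; split => //.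
  by apply/increasing_seqP => n; move/leW_mono: (sinc) => ->; move/increasing_seqP: s'inc.
exists x, (T x), (xi x); split => //; [by split => //; exact: BT|exact: xiL|].
move=> y b H; have -> : ip (xi x) y = \sum_i w x i * ip (zeta i) y.
  rewrite /xi; elim/big_rec2 : _ => [|i a z _ <-]; first by rewrite -(scale0r 0) ipZl mul0r.
  by rewrite ipDl ipZl.
apply: (simplex_sum_le (wS x Bx)) => i wi; apply: (H (q i) (zeta i) (qB i) _ (zetaP i)).
rewrite ltNge; apply/negP => ei; move/eqP: wi; apply.
exact: bump_weight_support.
Qed.

End Approximation.

Theorem theorem6 (R : realType)
  (V : completeNormedModType R) (V_refl : reflexive_space V)
  (X : completeNormedModType R) (ip : {dot X for idfun})
  (ip_norm : forall x : X, ip x x = `|x| ^+ 2)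
  (A : V -> dual V) (j : X -> X -> R) (M : {linear V -> X})
  (U : V -> set V) (phi : V -> R) (f : dual V)
  (mA d1 d2 d3 cphi : R)
  (A_pseudo : pseudomonotone A)
  (mA_gt0 : 0 < mA)
  (A_strong : forall v1 v2 : V,
     (A v1 - A v2) (v1 - v2) >= mA * `|v1 - v2| ^+ 2)
  (j_lip : forall w : X, locally_lipschitz (j w))
  (d1_ge0 : 0 <= d1) (d2_ge0 : 0 <= d2) (d3_ge0 : 0 <= d3)
  (j_growth : forall w v : X,
     (set_norm (clarke_subgradient ip (j w) v)
        <= (d1 + d2 * `|w| + d3 * `|v|)%:E)%E)
  (j_usc : upper_semicontinuous
     (fun p : X * X * X => clarke_derivative (j p.1.1) p.1.2 p.2))
  (M_bounded : exists c : R, forall v : V, `|M v| <= c * `|v|)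
  (M_compact : compact_map M)
  (U_nonempty : forall v : V, U v !=set0)
  (U_closed : forall v : V, closed (U v))
  (U_convex : forall v : V, convex_set (U v))
  (U_0 : forall v : V, U v 0)
  (U_mosco : weakly_mosco_continuous U)
  (phi_convex : convex_function (E := V) setT phi)
  (phi_lsc : lower_semicontinuous (fun v : V => (phi v)%:E))
  (cphi_gt0 : 0 < cphi)
  (phi_growth : forall v1 v2 : V, phi v1 - phi v2 <= cphi * `|v1 - v2|)
  (small : (d2 + d3) * opnorm M ^+ 2 < mA) :
  exists u : V, U u u /\
    forall z : V, U u z ->
      (0 <= ((A u - f) (z - u))%:E
            + clarke_derivative (j (M u)) (M u) (M z - M u)%R
            + (phi z)%:E - (phi u)%:E)%E.
Proof.
have cphi_ge0 : 0 <= cphi by exact: ltW.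
have phi_cvx : convexf phi.
  move=> x y t t0 t1; have tI : 0 <= t <= 1 by rewrite t0.
  have := phi_convex (Itv01 t0 t1) x y (in_setT _) (in_setT _).
  exact.
have [k_ge0 k_le] := (opnorm_ge0 M_bounded, le_opnorm M_bounded).
pose k := opnorm M.
pose d := mA - (d2 + d3) * k ^+ 2.
have d_gt0 : 0 < d by rewrite subr_gt0.
(* The radius at which the a priori bound reproduces itself: [mA r = |f| + |A 0| + cphi + k (d1 +
   (d2 + d3) k r)]. It exists because [small] makes [d] positive. *)
pose r := (`|f| + `|A 0| + cphi + k * d1) / d.
have num_ge0 : 0 <= `|f| + `|A 0| + cphi + k * d1 by rewrite !addr_ge0// mulr_ge0.
have r_ge0 : 0 <= r by rewrite divr_ge0// ltW.
pose L := d1 + (d2 + d3) * (k * r).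
have r_bound : `|f| + `|A 0| + cphi + opnorm M * L <= mA * r.
  have : r * d = `|f| + `|A 0| + cphi + k * d1 by rewrite /r divfK// gt_eqF.
  rewrite -/k /L /d expr2 => e; rewrite le_eqVlt; apply/orP; left; apply/eqP.
  have -> : mA * r = r * (mA - (d2 + d3) * (k * k)) + (d2 + d3) * (k * (k * r)) by ring.
  by rewrite e; ring.
pose S y := clarke_subgradient ip (j y) y.
have S_ex (w : V) : exists zeta, S (M w) zeta.
  have [p [L' [pE sp L'0 pL]]] := clarke_sublinear (M w) (j_lip (M w)).
  have [zeta zP] := sublinear_support ip_norm sp L'0 pL.
  by exists zeta => v; rewrite pE lee_fin.
have S_bound (w : V) zeta : `|w| <= r -> S (M w) zeta -> `|zeta| <= L.
  move=> wr Sz; have : (`|zeta|%:E <= (d1 + d2 * `|M w| + d3 * `|M w|)%:E)%E.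
    by apply: le_trans (j_growth (M w) (M w)); apply: ereal_sup_ubound; exists zeta.
  rewrite lee_fin => /le_trans; apply; rewrite -addrA lerD2l -mulrDl ler_wpM2l ?addr_ge0//.
  by rewrite (le_trans (k_le w))// ler_wpM2l.
have approx (n : nat) := approximate_solution V_refl ip_norm A_pseudo mA_gt0 A_strong M_bounded
  M_compact U_closed U_convex U_0 U_mosco phi_cvx cphi_ge0 phi_growth r_ge0 S_ex S_bound r_bound
  (harmonic_gt0 n).
have [x /choice[u /choice[xi P]]] := choice approx.
have [s1 [x0 [s1inc wx]]] := weak_seq_compact (fun n => let: And5 H _ _ _ _ := P n in H.1) V_refl.
have ur n : `|(u \o s1) n| <= r by case: (P (s1 n)) => -[].
have xiL n : `|(xi \o s1) n| <= L by case: (P (s1 n)).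
have sol n : solves ip A M U phi f ((x \o s1) n) ((xi \o s1) n) ((u \o s1) n).
  by case: (P (s1 n)).
have [s2 [u0 [s2inc uu Uu uP]]] := solves_stable V_refl ip_norm A_pseudo mA_gt0 A_strong M_bounded
  M_compact U_mosco phi_cvx phi_growth wx ur xiL sol.
pose s := s1 \o s2.
have s_cvg : s @ \oo --> \oo.
  exact: cvg_comp _ _ (increasing_seq_cvg s2inc) (increasing_seq_cvg s1inc).
have h0 : (s n).+1%:R^-1 @[n --> \oo] --> (0 : R).
  exact: (cvg_comp _ _ s_cvg cvg_harmonic).
have xu : x (s n) @[n --> \oo] --> u0.
  have c0 : (s n).+1%:R^-1 + `|u (s n) - u0| @[n --> \oo] --> (0 : R).
    by rewrite -[X in _ --> X](addr0 0); apply: cvgD => //; exact: cvg0_dist.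
  apply: (cvg_dist_le _ c0); apply: nearW => n.
  by rewrite (le_trans (ler_distD (u (s n)) _ _))// lerD2r; case: (P (s n)).
have x0u : x0 = u0.
  apply/eqP; rewrite -subr_eq0; apply/eqP/dual_separate => g.
  rewrite dualB; apply/eqP; rewrite subr_eq0; apply/eqP.
  have g1 : g (x (s n)) @[n --> \oo] --> g x0.
    exact: (cvg_comp _ _ (increasing_seq_cvg s2inc) (wx g)).
  have g2 : g (x (s n)) @[n --> \oo] --> g u0 by exact: dual_cvg.
  exact: (cvg_unique (@norm_hausdorff _ R^o) g1 g2).
subst x0; exists u0; split => // z Uz.
have [p [L' [pE _ _ _]]] := clarke_sublinear (M u0) (j_lip (M u0)).
rewrite pE -!EFinD lee_fin; apply/ler_addgt0Pl => e e0.
have pe : (clarke_derivative (j (M u0)) (M u0) (M z - M u0)%R < (p (M z - M u0)%R + e)%:E)%E.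
  by rewrite pE lte_fin ltrDl.
have [W Wn WP] := j_usc (M u0, M u0, M z - M u0) _ pe.
(* Only diagonal points are needed, since the averaged gradients are those of [j y] at [y] with
   [y = M q]; the direction stays fixed. *)
have [dl dl0 dlW] : exists2 dl : R, 0 < dl & forall y, `|y - M u0| < dl -> W (y, y, M z - M u0).
  have /nbhs_ballP[dl /= dl0 dlW] := Wn; exists dl => // y yu; apply: dlW.
  have yb : ball (M u0) dl y by rewrite -ball_normE /= distrC.
  by split; [split|exact: ballxx].
have near_b : \forall n \near \oo, ip ((xi \o s1) (s2 n)) (M z - M u0) <= p (M z - M u0) + e.
  have Mx : M (x (s n)) @[n --> \oo] --> M u0 by exact: bounded_linear_cvg.
  have H1 : \forall n \near \oo, `|M (x (s n)) - M u0| < dl / 2.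
    by apply: (cvgr_lt _ (cvg0_dist Mx)); rewrite divr_gt0.
  have H2 : \forall n \near \oo, (s n).+1%:R^-1 < dl / 2 :> R.
    by apply: (cvgr_lt _ h0); rewrite divr_gt0.
  apply: filterS2 H1 H2 => n h1 h2; have [_ _ _ _ H] := P (s n).
  apply: H => q zeta qr qx Sz.
  rewrite -lee_fin; apply: (le_trans (Sz _)); apply/ltW/(WP (M q, M q, M z - M u0))/dlW.
  rewrite (le_lt_trans (ler_distD (M (x (s n))) _ _))// (distrC (M q)).
  by move: (lt_trans qx h2) h1; lra.
have := uP z _ Uz near_b; lra.
Qed.
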